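(* Let $q\in\mathbb N_1$ and let $P_\bullet=(P_n)_{n\ge0}$ be a $q$-chromatic partition structure with block support $\Sigma(P_\bullet)$, satisfying: ($a_1$) $\mathbf e_j\in\Sigma(P_\bullet)$ for every $j\in[q]$; ($a_2$) $P_n[A]>0$ for every $n\in\mathbb N_1$ and every $A\in\mathcal A^{(q)}_n$ with $\mathrm{supp}\,A\subset\Sigma(P_\bullet)$; ($a_3$) there exists $\mathbf c\in\Sigma(P_\bullet)$ with $|\mathbf c|=2$; (b) for every $n\in\mathbb N_1$, every $A\in\mathcal A^{(q)}_n$, and every $\mathbf r\in\mathbb N^q_*$ with $\mathbf 1_{\mathbf r}\le A$, $$|\mathbf r|\,A(\mathbf r)\,P_n[A]=b(n,\mathbf r)\,P_{n-|\mathbf r|}[A-\mathbf 1_{\mathbf r}]$$ for some constant $b(n,\mathbf r)$ independent of $A$. Then $P_n=\mathscr E^n_{\theta,\nu}$ for every $n$, for a unique $\theta>0$ and a unique Borel probability measure $\nu$ on $\Delta^{q-1}$. Furthermore, $\Sigma(P_\bullet)=\Sigma_\nu:=\{\mathbf a\in\mathbb N_0^q:m_{\mathbf a}(\nu)>0\}$ and $b(n,\mathbf r)=b_*(n,\mathbf r)$ for all $n\in\mathbb N_1$ and $\mathbf r\in\mathbb N^q_*$ with $|\mathbf r|\le n$, where $$b_*(n,\mathbf r)=\binom{|\mathbf r|}{\mathbf r}\,\theta\,m_{\mathbf r}(\nu)\,\frac{\langle\theta\rangle_{n-|\mathbf r|}}{\langle\theta\rangle_n}\,\frac{n!}{(n-|\mathbf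 r|)!}.$$
   Context: Notation: $\mathbb N_1=\{1,2,\dots\}$, $\mathbb N_0=\{0,1,\dots\}$, $[q]=\{1,\dots,q\}$, $\mathbb N^q_*=\mathbb N_0^q\setminus\{\mathbf 0\}$, $0^0=1$; $|\mathbf a|=\sum_ja_j$, $\mathbf u^{\mathbf a}=\prod_ju_j^{a_j}$, $\binom{|\mathbf a|}{\mathbf a}=|\mathbf a|!/\prod_ja_j!$; $\mathbf e_j$ canonical basis vectors; $\Delta^{q-1}=\{\mathbf u\in[0,1]^q:|\mathbf u|=1\}$; $\langle\theta\rangle_n=\theta(\theta+1)\cdots(\theta+n-1)$ with $\langle\theta\rangle_0=1$; $m_{\mathbf a}(\nu)=\int_{\Delta^{q-1}}\mathbf u^{\mathbf a}\,d\nu(\mathbf u)$. A $q$-chromatic partition of $n\in\mathbb N_0$ is a finitely supported map $A\colon\mathbb N^q_*\to\mathbb N_0$ with $\sum_{\mathbf a}A(\mathbf a)|\mathbf a|=n$; $\mathcal A^{(q)}_n$ is the set of these ($\mathcal A^{(q)}_0=\{0\}$); $\mathbf 1_{\mathbf a}$ is the multiset with single element $\mathbf a$ (and $\mathbf 1_{\mathbf 0}$ is read as the empty multiset $0$); operations and $\le$ are pointwise; $\mathrm{supp}A$ is the support. For $\mathbf a\in\mathrm{supp}A$, $j\in[q]$ with $a_j\ge1$: $A_{\setminus\mathbf a,j}=A-\mathbf 1_{\mathbf a}$ if $\mathbf a=\mathbf e_j$, else $A-\mathbf 1_{\mathbf a}+\mathbf 1_{\mathbf a-\mathbf e_j}$.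 $S_{n-1,n}(A,B)=a_jA(\mathbf a)/n$ if $B=A_{\setminus\mathbf a,j}$, and $0$ otherwise. A $q$-chromatic partition structure is a sequence $(P_n)_{n\ge0}$ of probability measures $P_n$ on $\mathcal A^{(q)}_n$ with $P_{n-1}[B]=\sum_{A\in\mathcal A^{(q)}_n}P_n[A]\,S_{n-1,n}(A,B)$ for all $n\ge1$, $B\in\mathcal A^{(q)}_{n-1}$. Block support: $\Sigma(P_\bullet)=\{\mathbf a\in\mathbb N_0^q:P_{|\mathbf a|}[\mathbf 1_{\mathbf a}]>0\}$; note $\mathbf 0\in\Sigma(P_\bullet)$ since $P_0[0]=1$. Polychromatic Ewens Sampling Formula: $$\mathscr E^n_{\theta,\nu}[A]=\frac{n!}{\langle\theta\rangle_n}\prod_{\mathbf a\in\mathrm{supp}A}\frac1{A(\mathbf a)!}\Big(\frac{\theta}{|\mathbf a|}\binom{|\mathbf a|}{\mathbf a}m_{\mathbf a}(\nu)\Big)^{A(\mathbf a)},\qquad A\in\mathcal A^{(q)}_n.$$ *)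

(* Defs.v *)
From HB Require Import structures.
From mathcomp Require Import all_boot all_order all_algebra.
From mathcomp Require Import finmap multiset.
From mathcomp Require Import all_classical all_reals all_analysis.

Set Implicit Arguments.
Unset Strict Implicit.
Unset Printing Implicit Defensive.

Import Order.TTheory GRing.Theory Num.Theory.
Import numFieldNormedType.Exports.

Local Open Scope classical_set_scope.
Local Open Scope ring_scope.

Definition mindex (q : nat) := {ffun 'I_q -> nat}.

Definition mdeg (q : nat) (a : mindex q) : nat := (\sum_j a j)%N.

Definition munit (q : nat) (j : 'I_q) : mindex q := [ffun i => (i == j) : nat].

(* truncated at 0; only used when a j >= 1 *)
Definition mpred (q : nat) (a : mindex q) (j : 'I_q) : mindex q :=
  [ffun i => (a i - munit j i)%N].

(* A chromatic partition is encoded as a multiset of multi-indices (a finitely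
   supported function to nat) that does not contain the zero multi-index. *)
Definition chroms (q : nat) := {mset (mindex q)}%mset.

Definition chrompart (q n : nat) : set (chroms q) :=
  [set A : chroms q | A (0 : mindex q) = 0%N /\
    (\sum_(a <- finsupp A) A a * mdeg a)%N = n].
Arguments chrompart : clear implicits.

Definition msingle (q : nat) (a : mindex q) : chroms q :=
  if a == 0 then mset0 else [mset a]%mset.

Definition mremove (q : nat) (A : chroms q) (a : mindex q) (j : 'I_q) :
    chroms q :=
  if a == munit j then (A `\` msingle a)%mset
  else ((A `\` msingle a) `+` msingle (mpred a j))%mset.

(* At most one pair (a, j) contributes to this sum: see down_kernel_remove and
   down_kernel_eq0 below. *)
Definition down_kernel (R : realType) (q n : nat) (A B : chroms q) : R :=
  \sum_(a <- finsupp A) \sum_(j < q | (0 < a j)%N && (B == mremove A a j))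
    (a j * A a)%:R / n%:R.

(* P n A is the mass of A under the n-th law; only the values on
   chrompart q n, which is finite (finite_chrompart below), are meaningful. *)
Definition partition_structure (R : realType) (q : nat)
    (P : nat -> chroms q -> R) : Prop :=
  [/\ forall n A, chrompart q n A -> 0 <= P n A,
      forall n, \sum_(A \in chrompart q n) P n A = 1
    & forall n B, (0 < n)%N -> chrompart q n.-1 B ->
        P n.-1 B = \sum_(A \in chrompart q n) P n A * down_kernel R n A B].

Definition block_support (R : realType) (q : nat) (P : nat -> chroms q -> R) :
    set (mindex q) :=
  [set a | 0 < P (mdeg a) (msingle a)].

(* R^q with its Borel sigma-algebra *)
Notation borel_rV R q := (g_sigma_algebraType (@open 'rV[R]_q)).

Definition simplex (R : realType) (q : nat) : set 'rV[R]_q :=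
  [set u | (forall j, 0 <= u 0 j <= 1) /\ \sum_j u 0 j = 1].
Arguments simplex : clear implicits.

Definition monom (R : realType) (q : nat) (a : mindex q) (u : 'rV[R]_q) : R :=
  \prod_j u 0 j ^+ a j.

(* Borel probability measures on the simplex are encoded as Borel probability
   measures on R^q giving mass 1 to the simplex. *)
Definition on_simplex (R : realType) (q : nat)
    (nu : probability (borel_rV R q) R) : Prop :=
  nu (simplex R q) = 1%E.

Definition moment (R : realType) (q : nat)
    (nu : probability (borel_rV R q) R) (a : mindex q) : R :=
  \int[nu]_(u in simplex R q) monom a u.

Definition moment_support (R : realType) (q : nat)
    (nu : probability (borel_rV R q) R) : set (mindex q) :=
  [set a | 0 < moment nu a].

Definition rising (R : realType) (theta : R) (n : nat) : R :=
  \prod_(i < n) (theta + i%:R).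

Definition multinom_coef (R : realType) (q : nat) (a : mindex q) : R :=
  ((mdeg a)`!)%:R / (\prod_j (a j)`!)%:R.

Definition ewens (R : realType) (q : nat) (theta : R)
    (nu : probability (borel_rV R q) R) (n : nat) (A : chroms q) : R :=
  n`!%:R / rising theta n *
  \prod_(a <- finsupp A)
    ((A a)`!%:R^-1 *
     (theta / (mdeg a)%:R * multinom_coef R a * moment nu a) ^+ A a).

Definition bstar (R : realType) (q : nat) (theta : R)
    (nu : probability (borel_rV R q) R) (n : nat) (r : mindex q) : R :=
  multinom_coef R r * theta * moment nu r *
  (rising theta (n - mdeg r) / rising theta n) *
  (n`!%:R / (n - mdeg r)`!%:R).

Lemma munit_inj (q : nat) : injective (@munit q).
Proof.
move=> i j /ffunP/(_ i); rewrite !ffunE eqxx.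
by case: eqP.
Qed.

Lemma munit_neq0 (q : nat) (j : 'I_q) : munit j != 0.
Proof. by apply/eqP => /ffunP/(_ j); rewrite !ffunE eqxx. Qed.

Lemma msingleE (q : nat) (a : mindex q) c : msingle a c = (a != 0) && (c == a) :> nat.
Proof.
rewrite /msingle; case: eqP => _ /=; first by rewrite mset0E.
by rewrite msetnE; case: eqP.
Qed.

Lemma mpred_eq0 (q : nat) (a : mindex q) j : (0 < a j)%N ->
  (mpred a j == 0) = (a == munit j).
Proof.
move=> aj; apply/eqP/eqP => [/ffunP h|->].
  apply/ffunP => i; move: (h i); rewrite !ffunE; case: eqVneq => [->|_]/=.
    by move=> /eqP; rewrite subn_eq0 => aj1; apply/eqP; rewrite eqn_leq aj1 aj.
  by rewrite subn0.
by apply/ffunP => i; rewrite !ffunE subnn.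
Qed.

Lemma mpred_neq (q : nat) (a : mindex q) j : (0 < a j)%N -> mpred a j != a.
Proof.
move=> aj; apply/eqP => /ffunP/(_ j); rewrite !ffunE eqxx.
by case: (a j) aj => // k _; rewrite subn1 /= => /n_Sn.
Qed.

Lemma mpred_inj (q : nat) (a : mindex q) i j : (0 < a i)%N -> (0 < a j)%N ->
  mpred a i = mpred a j -> i = j.
Proof.
move=> ai aj /ffunP/(_ i); rewrite !ffunE eqxx.
case: eqVneq => // _; rewrite subn0.
by case: (a i) ai => // k _; rewrite subn1 /= => /n_Sn.
Qed.

Lemma mremoveE (q : nat) (A : chroms q) (a : mindex q) j c : (0 < a j)%N ->
  mremove A a j c = (A c - (c == a) + ((a != munit j) && (c == mpred a j)))%N.
Proof.
move=> aj; have a0 : a != 0.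
  by apply: contraTneq aj => ->; rewrite ffunE.
rewrite /mremove; case: eqVneq => /= [aE|aN].
  by rewrite !msetE2 msingleE a0 addn0.
rewrite !msetE2 !msingleE a0 /=.
by rewrite mpred_eq0 // aN.
Qed.

Lemma mremove_inj (q : nat) (A : chroms q) (a a' : mindex q) i j :
  a \in finsupp A -> a' \in finsupp A -> (0 < a i)%N -> (0 < a' j)%N ->
  mremove A a i = mremove A a' j -> a = a' /\ i = j.
Proof.
rewrite !msuppE !in_mset => Aa Aa' ai aj E.
have EE c : mremove A a i c = mremove A a' j c by rewrite E.
have aa' : a = a'.
  apply/eqP/negPn/negP => na; move: (EE a).
  rewrite !mremoveE // eqxx (negbTE na) subn0 (eq_sym a (mpred a i)) (negbTE (mpred_neq ai)).
  rewrite andbF addn0 => h.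
  by move: Aa (leq_addr ((a' != munit j) && (a == mpred a' j)) (A a));
    rewrite -h; case: (A a) => // k _; rewrite subn1 /= ltnn.
subst a'; split=> //.
have [ei|ni] := eqVneq a (munit i); have [ej|nj] := eqVneq a (munit j).
- by apply: (@munit_inj q); rewrite -ei -ej.
- move: (EE (mpred a j)); rewrite !mremoveE // nj [in a != munit i]ei !eqxx /=.
  by rewrite addn0 addn1 => /n_Sn.
- move: (EE (mpred a i)); rewrite !mremoveE // ni [in a != munit j]ej !eqxx /=.
  by rewrite addn0 addn1 => /esym/n_Sn.
- apply: (mpred_inj ai aj); apply/eqP; move: (EE (mpred a i)).
  rewrite !mremoveE // ni nj /= eqxx /=.
  by move/addnI; case: eqP.
Qed.

Lemma down_kernel_remove (R : realType) (q n : nat) (A : chroms q) (a : mindex q) j :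
  a \in finsupp A -> (0 < a j)%N ->
  down_kernel R n A (mremove A a j) = (a j * A a)%:R / n%:R.
Proof.
move=> Aa aj; rewrite /down_kernel (big_fsetD1 a) //=.
rewrite [X in _ + X]big_seq_cond [X in _ + X]big1 ?addr0.
  rewrite (bigD1 j) /=; last by rewrite aj eqxx.
  rewrite big1 ?addr0 // => i /andP[/andP[ai /eqP E]] /eqP[].
  by have [_ ->] := mremove_inj Aa Aa aj ai E.
move=> c; rewrite andbT !inE => /andP[/eqP nc Ac].
rewrite big1 // => i /andP[ci /eqP E]; case: nc.
by have [-> _] := mremove_inj Aa Ac aj ci E.
Qed.

Lemma down_kernel_eq0 (R : realType) (q n : nat) (A B : chroms q) :
  (forall (a : mindex q) j, a \in finsupp A -> (0 < a j)%N -> B <> mremove A a j) ->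
  down_kernel R n A B = 0.
Proof.
move=> h; rewrite /down_kernel big_seq big1 // => a Aa.
by rewrite big1 // => j /andP[aj /eqP]; move: (h a j Aa aj).
Qed.

Lemma finite_chrompart (q n : nat) : finite_set (chrompart q n).
Proof.
pose emb (x : {ffun 'I_q -> 'I_n.+1}) : mindex q := [ffun i => x i : nat].
pose prj (a : mindex q) : {ffun 'I_q -> 'I_n.+1} := [ffun i => inord (a i)].
pose G (g : {ffun {ffun 'I_q -> 'I_n.+1} -> 'I_n.+1}) : chroms q :=
  [fsfun a in [fset emb x | x in {ffun 'I_q -> 'I_n.+1}]%fset => g (prj a) : nat].
apply: (@sub_finite_set _ _ [set G g | g in setT]); last first.
  by apply: finite_image; exact: finite_finset.
move=> A [A0 An]; exists [ffun x => inord (A (emb x))] => //.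
have bnd a : a \in finsupp A -> (A a * mdeg a <= n)%N.
  by move=> Aa; rewrite -An (big_fsetD1 a) //= leq_addr.
have embK a : a \in finsupp A -> emb (prj a) = a /\ (A a <= n)%N.
  move=> Aa; have := bnd a Aa; have a0 : a != 0.
    by apply/eqP => a0; move: Aa; rewrite a0 msuppE in_mset A0.
  have [j aj] : exists j, (0 < a j)%N.
    apply: contrapT => h; case/eqP: a0; apply/ffunP => i; rewrite ffunE.
    by case: (posnP (a i)) => // ai; case: h; exists i.
  have mpos : (0 < mdeg a)%N by rewrite /mdeg (bigD1 j) //= addn_gt0 aj.
  have Apos : (0 < A a)%N by move: Aa; rewrite msuppE in_mset.
  move=> h; split; last by apply: leq_trans h; rewrite leq_pmulr.
  apply/ffunP => i; rewrite !ffunE inordK // ltnS.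
  apply: (@leq_trans (mdeg a)); first by rewrite /mdeg (bigD1 i) //= leq_addr.
  by apply: leq_trans h; rewrite leq_pmull.
apply/msetP => a; rewrite /G fsfunE; case: ifP => [/imfsetP[x _ ->]|aN].
  rewrite ffunE; have -> : prj (emb x) = x.
    by apply/ffunP => i; rewrite !ffunE inord_val.
  rewrite inordK //; have [Ax|Ax] := boolP (emb x \in finsupp A).
    by rewrite ltnS; have [] := embK _ Ax.
  by move: Ax; rewrite msuppE => /mset_eq0P ->.
apply/esym/mset_eq0P; rewrite -msuppE; apply/negP => Aa.
move/negP: aN; apply; apply/imfsetP; exists (prj a) => //.
by have [->] := embK a Aa.
Qed.

Lemma measurable_simplex (R : realType) (q : nat) :
  measurable (simplex R q : set (borel_rV R q)).
Proof.
rewrite -[X in measurable X]setCK; apply: measurableC.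
apply: sub_sigma_algebra.
have coord j : continuous (fun u : 'rV[R]_q => u 0 j) by exact: coord_continuous.
have -> : simplex R q = (\bigcap_(j in [set: 'I_q])
    ((fun u : 'rV[R]_q => u 0 j) @^-1` `[0, 1])) `&`
    ((fun u : 'rV[R]_q => \sum_j u 0 j) @^-1` [set 1]).
  apply/seteqP; split=> u /= [h1 h2]; split=> // j.
    by move=> _ /=; rewrite in_itv /=.
  by move: (h1 j I); rewrite /= in_itv.
apply: closed_openC; apply: closedI.
  apply: closed_bigI => j _; apply: preimage_closed; last exact: interval_closed.
  by move=> u _; exact: coord.
apply: preimage_closed; last exact: closed_eq.
move=> u _; apply: cvg_big => [||j _]; [exact: add_continuous| |exact: coord].
exact: (nbhs_filter (u : 'rV[R]_q)).
Qed.

(* Main.v *)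
Require Import Defs.
From HB Require Import structures.
From mathcomp Require Import all_boot all_order all_algebra.
From mathcomp Require Import finmap multiset.
From mathcomp Require Import all_classical all_reals all_analysis.
From mathcomp Require Import measurable_realfun ring lra.

Set Implicit Arguments.
Unset Strict Implicit.
Unset Printing Implicit Defensive.

Import Order.TTheory GRing.Theory Num.Theory.
Import numFieldNormedType.Exports.

Local Open Scope classical_set_scope.
Local Open Scope ring_scope.

(** The theorem splits into an algebraic half, which computes [P] up to a sequence
    of nonnegative numbers [m a], and an analytic half, which recognises these
    numbers as the moments of a measure on the simplex.

    Gibbs form. Let [e] be a singleton block. A partition made of one block [r]
    and of singletons can lose [r] and then [e], or [e] and then [r]; since all
    the masses involved are positive, the deletion hypothesis gives
    b(n, r) b(n - |r|, e) = b(n, e) b(n - 1, r) ([rate_commute]). Hence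
    b(n, r) = w(r) W_n / W_(n - |r|), where W_n is the product of the first [n]
    ratios b(k, e) ([ratio_factorization]), and taking the blocks off one by one
    yields P_n[A] = W_n times the product of (w(a) / |a|)^A(a) / A(a)!
    ([gibbs_form]).

    Consistency. The partitions that become [B] after the loss of one unit are
    obtained from [B] by adding a unit, either as a new singleton or to an
    existing block ([consistency_identity]). For [B] made of [n] singletons this
    reads n + 1 = b(n + 1, e) (E + n g), with E the sum of w over the unit
    vectors and [g] a constant ([rateE]); for [B] a single block [c] it then
    becomes a linear recursion between w(c) and the w(c + e_j)
    ([lifted_weightE]). The block of size two forces g > 0
    ([lifted_weight_gt0]), so that with theta = E / g one gets
    W_n = n! / (g^n <theta>_n), and
    m(a) = w(a) / (g^|a| theta binom(|a|, a)) satisfies m(0) = 1 and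
    m(c) = sum_j m(c + e_j) ([moment_weight_recursion]).

    Moment problem. A nonnegative solution of this recursion is the moment
    sequence of a probability on the simplex ([exists_representing_measure]).
    This is de Finetti's theorem: giving a word in the colours the weight [m] of
    its colour counts defines an exchangeable random word, realised here on
    [0, 1[ with nested intervals as the successive cells ([integral_word]). The
    frequencies of the colours are Cauchy in mean square
    ([wordsum_freq_cauchy]), hence converge almost everywhere along lengths that
    grow geometrically; the law of their limit is the measure. Its moments are
    [m] because products of falling factorials of the counts have an exact
    expectation ([wordsum_ffact_prod]).

    Uniqueness. The masses of two singletons and of a single block return theta
    and the moments ([ewens_injective]). The moments determine the integral of
    each Bernstein polynomial, hence of each Lipschitz function
    ([bernstein_integral_cvg]), hence the measure of each open set
    ([eq_measure_of_moments]). *)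

(** * Multi-indices *)

Section MultiIndices.
Variable q : nat.
Implicit Types (a c : mindex q) (j : 'I_q).

Lemma maddE a c j : (a + c) j = (a j + c j)%N.
Proof. by rewrite ffunE. Qed.

Lemma mdegD a c : mdeg (a + c) = (mdeg a + mdeg c)%N.
Proof. by rewrite /mdeg -big_split; apply: eq_bigr => j _; rewrite maddE. Qed.

Lemma mdeg0 : mdeg (0 : mindex q) = 0%N.
Proof. by rewrite /mdeg big1 // => j _; rewrite ffunE. Qed.

Lemma munitE j i : munit j i = (i == j) :> nat.
Proof. by rewrite ffunE. Qed.

Lemma mdeg_unit j : mdeg (munit j) = 1%N.
Proof.
rewrite /mdeg (bigD1 j) //= munitE eqxx big1 ?addn0 // => i /negbTE ij.
by rewrite munitE ij.
Qed.

Lemma mpredE a j i : mpred a j i = (a i - (i == j))%N.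
Proof. by rewrite ffunE munitE. Qed.

Lemma mpredK a j : (0 < a j)%N -> mpred a j + munit j = a.
Proof.
move=> aj; apply/ffunP => i; rewrite maddE mpredE munitE.
by case: eqVneq => [->|_]; rewrite ?subnK // subn0 addn0.
Qed.

Lemma maddK a j : mpred (a + munit j) j = a.
Proof. by apply/ffunP => i; rewrite mpredE maddE munitE addnK. Qed.

Lemma mdeg_pred a j : (0 < a j)%N -> mdeg a = (mdeg (mpred a j)).+1.
Proof. by move=> aj; rewrite -{1}(mpredK aj) mdegD mdeg_unit addn1. Qed.

Lemma mdeg_eq0 a : (mdeg a == 0%N) = (a == 0).
Proof.
apply/idP/eqP => [|->]; last by rewrite mdeg0.
rewrite /mdeg sum_nat_eq0 => /forallP h; apply/ffunP => j.
by rewrite ffunE; apply/eqP; exact: h.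
Qed.

Lemma mdeg_gt0 a : (0 < mdeg a)%N = (a != 0).
Proof. by rewrite lt0n mdeg_eq0. Qed.

Lemma madd_unit_neq0 a j : a + munit j != 0.
Proof. by rewrite -mdeg_gt0 mdegD mdeg_unit addn1. Qed.

Lemma mdeg_gt0_coord a : (0 < mdeg a)%N -> exists j, (0 < a j)%N.
Proof.
move=> a0; apply/existsP; apply: contraTT a0; rewrite negb_exists => /forallP h.
rewrite lt0n negbK /mdeg big1 // => j _.
by apply/eqP; have := h j; rewrite -eqn0Ngt.
Qed.

Lemma mdeg1P a : mdeg a = 1%N -> exists j, a = munit j.
Proof.
move=> a1; have [|j aj] := @mdeg_gt0_coord a; first by rewrite a1.
exists j; apply/eqP; rewrite -(mpred_eq0 aj) -mdeg_eq0.
by move: a1; rewrite (mdeg_pred aj) => -[->].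
Qed.

End MultiIndices.

(** * Sums over words of weights satisfying the moment recursion *)

(** Pascal's rule for the falling factorial: among the choices of [k] distinct
    elements in order, those that use a given element have [k] places for it. *)
Lemma ffactSD n k : (n.+1 ^_ k = n ^_ k + k * n ^_ k.-1)%N.
Proof.
case: k => [|k]; first by rewrite !ffactn0.
rewrite ffactSS ffactnSr /=; case: (leqP k n) => kn; last by rewrite ffact_small ?muln0.
by rewrite [X in (X + _)%N]mulnC -mulnDl addnS subnK.
Qed.

Section Words.
Variables (R : comNzRingType) (q : nat).
Implicit Types (m : mindex q -> R) (c : mindex q) (f g : seq 'I_q -> R).

(** When [m] is nonnegative and satisfies [m d = \sum_j m (d + munit j)], this
    is [m c] times the expectation of [f] at the next [n] colours of an
    exchangeable sequence, given that the colours seen so far have counts [c]. *)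
Fixpoint wordsum m n c f : R :=
  if n is n'.+1 then \sum_j wordsum m n' (c + munit j) (fun x => f (j :: x))
  else m c * f [::].

Lemma eq_wordsum m n c f g :
  (forall x, size x = n -> f x = g x) -> wordsum m n c f = wordsum m n c g.
Proof.
elim: n c f g => [|n IH] c f g fg /=; first by rewrite fg.
by apply: eq_bigr => j _; apply: IH => x xn; apply: fg; rewrite /= xn.
Qed.

Arguments eq_wordsum {m n c f} g _.

Lemma eq_wordsuml m m' n c f : m =1 m' -> wordsum m n c f = wordsum m' n c f.
Proof.
move=> mm; elim: n c f => [|n IH] c f /=; first by rewrite mm.
by apply: eq_bigr => j _; exact: IH.
Qed.

Arguments eq_wordsuml {m} m' {n c f} _.

Lemma wordsumD m n c f g :
  wordsum m n c (fun x => f x + g x) = wordsum m n c f + wordsum m n c g.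
Proof.
elim: n c f g => [|n IH] c f g /=; first by rewrite mulrDr.
by rewrite -big_split; apply: eq_bigr => j _; exact: IH.
Qed.

Lemma wordsumZ m n c k f : wordsum m n c (fun x => k * f x) = k * wordsum m n c f.
Proof.
elim: n c f => [|n IH] c f /=; first by rewrite mulrCA.
by rewrite mulr_sumr; apply: eq_bigr => j _; exact: IH.
Qed.

Lemma wordsum_sum m n c (I : finType) (F : I -> seq 'I_q -> R) :
  wordsum m n c (fun x => \sum_i F i x) = \sum_i wordsum m n c (F i).
Proof.
elim: n c F => [|n IH] c F /=; first by rewrite mulr_sumr.
rewrite exchange_big; apply: eq_bigr => j _; exact: IH.
Qed.

(** Conditioning on the first [n] letters: what the last [p] letters contribute
    depends on the first ones only through their counts, so it acts as a new
    weight. *)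
Lemma wordsum_cat m n p c f g :
  wordsum m (n + p) c (fun x => f (take n x) * g (drop n x)) =
  wordsum (fun d => wordsum m p d g) n c f.
Proof.
elim: n c f => [|n IH] c f /=; last by apply: eq_bigr => j _; exact: IH.
rewrite add0n mulrC -wordsumZ; apply: eq_wordsum => x _.
by rewrite take0 drop0.
Qed.

(** The number of ways to choose, for each colour [j], a sequence of [a j]
    distinct positions of the letter [j]. Unlike the powers of the counts, it has
    an exact expectation. *)
Definition ffact_prod (a : mindex q) (x : seq 'I_q) : nat :=
  \prod_j (count_mem j x) ^_ (a j).

Lemma ffact_prod_cons a i x :
  ffact_prod a (i :: x) = (ffact_prod a x + a i * ffact_prod (mpred a i) x)%N.
Proof.
rewrite /ffact_prod (bigD1 i) //= eqxx add1n ffactSD mulnDl.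
rewrite [in RHS](bigD1 i) //= [X in (_ + a i * X)%N](bigD1 i) //= mulnA.
rewrite mpredE eqxx subn1; congr (_ * _ + _ * _)%N;
  by apply: eq_bigr => j /negbTE ji; rewrite ?mpredE ?[i == _]eq_sym ji ?subn0.
Qed.

(** Each of the [n ^_ (mdeg a)] ways to prescribe [a j] positions for every
    colour [j] is realised with the same weight [m (c + a)], by exchangeability.
    The induction on the first letter counts the choices that avoid it and those
    that use it. *)
Lemma wordsum_ffact_prod m n c a : (forall d, m d = \sum_j m (d + munit j)) ->
  wordsum m n c (fun x => (ffact_prod a x)%:R) = (n ^_ (mdeg a))%:R * m (c + a).
Proof.
move=> mS; elim: n c a => [|n IH] c a /=.
  rewrite mulrC ffact0n /ffact_prod; case: eqVneq => [/eqP|].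
    rewrite mdeg_eq0 => /eqP ->; rewrite addr0 big1 // => j _.
    by rewrite ffunE ffactn0.
  move=> /eqP/eqP; rewrite -lt0n => /mdeg_gt0_coord[j aj].
  by rewrite (bigD1 j) //= ffact0n gtn_eqF // !mul0r.
transitivity (\sum_j ((n ^_ (mdeg a))%:R * m (c + a + munit j)
    + (a j)%:R * ((n ^_ (mdeg a).-1)%:R * m (c + a)))).
  apply: eq_bigr => j _.
  rewrite (eq_wordsum (fun x => (ffact_prod a x)%:R
      + (a j)%:R * (ffact_prod (mpred a j) x)%:R)); last first.
    by move=> x _; rewrite ffact_prod_cons natrD natrM.
  rewrite wordsumD wordsumZ !IH (addrAC c a); congr (_ + _).
  have [->|aj] := posnP (a j); first by rewrite !mul0r.
  by rewrite (mdeg_pred aj) -addrA [munit j + _]addrC mpredK.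
rewrite big_split /= -mulr_sumr -mS -mulr_suml -natr_sum -/(mdeg a).
by rewrite mulrA -natrM -mulrDl -natrD -ffactSD.
Qed.

Lemma ffact_prod1 (j : 'I_q) (x : seq 'I_q) : ffact_prod (munit j) x = count_mem j x.
Proof.
rewrite /ffact_prod (bigD1 j) //= munitE eqxx ffactn1 big1 ?muln1 // => i /negbTE ij.
by rewrite munitE ij.
Qed.

Lemma ffact_prod2 (j : 'I_q) (x : seq 'I_q) :
  (ffact_prod (munit j + munit j)%R x + count_mem j x = count_mem j x ^ 2)%N.
Proof.
rewrite /ffact_prod (bigD1 j) //= maddE munitE eqxx big1 => [|i /negbTE ij].
  rewrite muln1; case: (count_mem j x) => // k.
  by rewrite ffactSS ffactn1 -mulnSr expnS expn1.
by rewrite maddE munitE ij.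
Qed.

Section Moments.
Variables (m : mindex q -> R) (mS : forall d, m d = \sum_j m (d + munit j)).

Lemma wordsum_cst n c k : wordsum m n c (fun=> k) = m c * k.
Proof.
have := wordsum_ffact_prod n c 0 mS; rewrite mdeg0 ffactn0 mul1r addr0 => <-.
rewrite mulrC -wordsumZ; apply: eq_wordsum => x _.
by rewrite /ffact_prod big1 ?mulr1 // => j _; rewrite ffunE ffactn0.
Qed.

Lemma wordsum_count n c j :
  wordsum m n c (fun x => (count_mem j x)%:R) = n%:R * m (c + munit j).
Proof.
have := wordsum_ffact_prod n c (munit j) mS; rewrite mdeg_unit ffactn1 => <-.
by apply: eq_wordsum => x _; rewrite ffact_prod1.
Qed.

Lemma wordsum_count2 n c j :
  wordsum m n c (fun x => (count_mem j x)%:R ^+ 2) =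
  (n * n.-1)%:R * m (c + munit j + munit j) + n%:R * m (c + munit j).
Proof.
have := wordsum_ffact_prod n c (munit j + munit j) mS.
rewrite mdegD mdeg_unit addn1 addrA => E.
have -> : (n * n.-1)%N = n ^_ 2 by case: n {E} => // n; rewrite ffactSS ffactn1.
rewrite -E -wordsum_count -wordsumD; apply: eq_wordsum => x _.
by rewrite -natrD ffact_prod2 natrX.
Qed.

End Moments.

End Words.

Arguments eq_wordsum {R q m n c f} g _.
Arguments eq_wordsuml {R q m} m' {n c f} _.

Section Variance.
Variables (R : realFieldType) (q : nat) (m : mindex q -> R).
Hypotheses (mS : forall d, m d = \sum_j m (d + munit j)) (m0 : forall d, 0 <= m d).

Lemma wordsum_le n c f g : (forall x, size x = n -> f x <= g x) ->
  wordsum m n c f <= wordsum m n c g.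
Proof.
elim: n c f g => [|n IH] c f g fg /=; first by rewrite ler_wpM2l // fg.
by apply: ler_sum => j _; apply: IH => x xn; apply: fg; rewrite /= xn.
Qed.

Definition freq (n : nat) (x : seq 'I_q) (j : 'I_q) : R :=
  (count_mem j x)%:R / n%:R.

Definition row_freq n x : 'rV[R]_q := \row_j freq n x j.

(** The indicators of [j] at the different positions have one common mean and
    one common pair correlation, so the left hand side equals
    [(m (c + e) - m (c + e + e)) * (n%:R^-1 - (n + p)%:R^-1)]; the bound does not
    depend on [p]. *)
Lemma wordsum_freq_cauchy n p c j : (0 < n)%N ->
  wordsum m (n + p) c (fun x => (freq (n + p) x j - freq n (take n x) j) ^+ 2)
    <= m (c + munit j) / n%:R.
Proof.
move=> n0; set e := munit j.
have n0R : (0 : R) < n%:R by rewrite ltr0n.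
have p0R : (0 : R) <= p%:R by rewrite ler0n.
have mS' (b : mindex q) d : m (d + b) = \sum_i m (d + munit i + b).
  by rewrite mS; apply: eq_bigr => i _; rewrite addrAC.
pose N : R := (n + p)%:R.
have NE : N = n%:R + p%:R by rewrite /N natrD.
have nnz : n%:R != 0 :> R by rewrite lt0r_neq0.
have nNz : n%:R + p%:R != 0 :> R by rewrite lt0r_neq0 // ltr_wpDr.
pose K (x : seq 'I_q) : R := (count_mem j x)%:R.
pose one (_ : seq 'I_q) : R := 1.
have ELL : wordsum m (n + p) c (fun x => one (take n x) * K (drop n x) ^+ 2) =
    (p * p.-1)%:R * m (c + e + e) + p%:R * m (c + e).
  rewrite (wordsum_cat m n p c one (fun y => K y ^+ 2)).
  rewrite (eq_wordsuml (fun d => (p * p.-1)%:R * m (d + e + e) + p%:R * m (d + e))).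
    rewrite wordsum_cst ?mulr1 // => d.
    by rewrite big_split -!mulr_sumr (mS' e d) -!addrA (mS' (e + e));
      under eq_bigr do rewrite addrA.
  by move=> d; rewrite wordsum_count2.
have EKL : wordsum m (n + p) c (fun x => K (take n x) * K (drop n x)) =
    n%:R * p%:R * m (c + e + e).
  rewrite wordsum_cat (eq_wordsuml (fun d => p%:R * m (d + e))).
    rewrite wordsum_count; last by move=> d; rewrite -mulr_sumr -mS'.
    by rewrite mulrA.
  by move=> d; rewrite wordsum_count.
have EKK : wordsum m (n + p) c (fun x => K (take n x) ^+ 2 * one (drop n x)) =
    (n * n.-1)%:R * m (c + e + e) + n%:R * m (c + e).
  rewrite (wordsum_cat m n p c (fun y => K y ^+ 2) one).
  rewrite (eq_wordsuml m) ?wordsum_count2 //.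
  by move=> d; rewrite wordsum_cst ?mulr1.
(* The increment is N^-1 (K (drop n x) - (p / n) K (take n x)). *)
rewrite (eq_wordsum (fun x => N ^- 2 * (one (take n x) * K (drop n x) ^+ 2) +
   ((- 2 * p%:R / n%:R / N ^+ 2) * (K (take n x) * K (drop n x)) +
    (p%:R ^+ 2 / n%:R ^+ 2 / N ^+ 2) * (K (take n x) ^+ 2 * one (drop n x)))));
    last first.
  move=> x _; rewrite /freq -/N.
  have -> : (count_mem j x)%:R = K (take n x) + K (drop n x).
    by rewrite -natrD -count_cat cat_take_drop.
  rewrite /one -/(K (take n x)) NE; field.
  by rewrite nnz nNz.
rewrite wordsumD wordsumZ ELL wordsumD wordsumZ EKL wordsumZ EKK.
have predE k : (k * k.-1)%:R = k%:R ^+ 2 - k%:R :> R.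
  by case: k => [|k]; rewrite ?expr0n /= ?subrr // natrM -[k.+1]addn1 natrD; ring.
rewrite !predE.
set m1 := m (c + e); set m2 := m (c + e + e).
have m20 : 0 <= m2 by exact: m0.
have m10 : 0 <= m1 by exact: m0.
rewrite [X in X <= _](_ : _ = (m1 - m2) / n%:R * (p%:R / N)); last first.
  by rewrite NE; field; rewrite nnz nNz.
have N0 : 0 < N by rewrite NE ltr_wpDr.
have m21 : m2 <= m1.
  by rewrite /m1 mS (bigD1 j) //= lerDl sumr_ge0.
apply: (@le_trans _ _ ((m1 - m2) / n%:R)).
  rewrite ler_piMr //; first by rewrite divr_ge0 ?subr_ge0 // ltW.
  by rewrite ler_pdivrMr // mul1r NE lerDr ltW.
by rewrite ler_wpM2r ?invr_ge0 ?(ltW n0R) // gerBl.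
Qed.

End Variance.

Arguments row_freq {R q} n x.

(** * Realising the weights as lengths of nested intervals *)

Section Coding.
Variables (R : realType) (q : nat) (m : mindex q -> R) (j0 : 'I_q).
Hypotheses (mS : forall d, m d = \sum_j m (d + munit j)) (m0 : forall d, 0 <= m d).
Implicit Types (c : mindex q) (l t : R) (f : seq 'I_q -> R).

Definition offset c (k : nat) : R := \sum_(i < q | (i < k)%N) m (c + munit i).

Lemma offset0 c : offset c 0 = 0.
Proof. by rewrite /offset big_pred0. Qed.

Lemma offset_full c : offset c q = m c.
Proof. by rewrite mS; apply: eq_bigl => i; rewrite ltn_ord. Qed.

Lemma offsetS c (j : 'I_q) : offset c j.+1 = offset c j + m (c + munit j).
Proof.
rewrite /offset (bigD1 j) //= addrC; congr (_ + _).
by apply: eq_bigl => i; rewrite ltnS ltn_neqAle andbC.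
Qed.

Lemma offset_le c k k' : (k <= k')%N -> offset c k <= offset c k'.
Proof.
move=> kk'; rewrite [leRHS](bigID (fun i : 'I_q => (i < k)%N)) /=.
rewrite -[leLHS]addr0 lerD ?sumr_ge0 // le_eqVlt; apply/orP; left; apply/eqP.
apply: eq_bigl => i; case: (ltnP i k) => [ik|]; last by rewrite andbF.
by rewrite (leq_trans ik).
Qed.

(** The set of the parameters whose word has started with colour counts [c];
    several words have these counts, and [l] tells their intervals apart. *)
Definition cell l c : set R := `[l, l + m c[.

(** Outside of [cell l c] no colour is selected and [j0] is returned. *)
Definition letter l c t : 'I_q :=
  odflt j0 [pick j : 'I_q | offset c j <= t - l < offset c j.+1].

Lemma letterP l c (j : 'I_q) t :
  offset c j <= t - l < offset c j.+1 -> letter l c t = j.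
Proof.
move=> /andP[tj tj']; rewrite /letter; case: pickP => [i /andP[ti ti']|/(_ j)].
  apply/val_inj/eqP; rewrite eqn_leq; apply/andP; split; rewrite leqNgt;
    apply/negP => h.
    by have := lt_le_trans tj' (le_trans (offset_le c h) ti); rewrite ltxx.
  by have := lt_le_trans ti' (le_trans (offset_le c h) tj); rewrite ltxx.
by rewrite tj tj'.
Qed.

Lemma cellE l c (j : 'I_q) t : cell (l + offset c j) (c + munit j) t =
  (offset c j <= t - l < offset c j.+1) :> Prop.
Proof.
by rewrite /cell /= in_itv /= offsetS lerBrDl ltrBlDl addrA.
Qed.

Lemma cell_cover l c : cell l c =
  \bigcup_(j in [set: 'I_q]) cell (l + offset c j) (c + munit j).
Proof.
apply/seteqP; split => t.
  rewrite /cell /= in_itv /= => /andP[lt tl].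
  have ex : exists k, t - l < offset c k.
    by exists q; rewrite offset_full ltrBlDl.
  (* The colour sought is the predecessor of the least offset index above t - l. *)
  case: (ex_minnP ex) => -[|k] tk kmin.
    by move: tk; rewrite offset0 ltNge subr_ge0 lt.
  have kq : (k < q)%N by apply: kmin; rewrite offset_full ltrBlDl.
  exists (Ordinal kq) => //.
  suff : cell (l + offset c (Ordinal kq)) (c + munit (Ordinal kq)) t by [].
  rewrite cellE /= tk andbT leNgt.
  by apply/negP => /kmin; rewrite ltnn.
move=> [j _]; rewrite cellE => /andP[h1 h2]; rewrite /cell /= in_itv /=.
apply/andP; split.
  by rewrite -subr_ge0; apply: le_trans h1; rewrite -(offset0 c) offset_le.
by rewrite -ltrBlDl (lt_le_trans h2) // -offset_full offset_le.
Qed.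

Lemma cell_trivIset l c (D : set 'I_q) :
  trivIset D (fun j => cell (l + offset c j) (c + munit j)).
Proof.
move=> i j _ _ [t []]; rewrite !cellE => ti tj.
by rewrite -(letterP ti) (letterP tj).
Qed.

Fixpoint word n l c t : seq 'I_q :=
  if n is n'.+1 then
    let j := letter l c t in j :: word n' (l + offset c j) (c + munit j) t
  else [::].

Lemma size_word n l c t : size (word n l c t) = n.
Proof. by elim: n l c => //= n IH l c; rewrite IH. Qed.

Lemma take_word n p l c t : take n (word (n + p) l c t) = word n l c t.
Proof. by elim: n l c => [|n IH] l c /=; rewrite ?take0 // IH. Qed.

Lemma measurable_cell l c : measurable (cell l c).
Proof. exact: measurable_itv. Qed.

Lemma word_letter n l c (j : 'I_q) t : cell (l + offset c j) (c + munit j) t ->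
  word n.+1 l c t = j :: word n (l + offset c j) (c + munit j) t.
Proof. by rewrite cellE => /letterP /= ->. Qed.

(** The preimage is a finite union of cells, whatever [Y] is; functions of the
    word are then measurable into any space. *)
Lemma measurable_word n l c (Y : set (seq 'I_q)) :
  measurable (cell l c `&` word n l c @^-1` Y).
Proof.
elim: n l c Y => [|n IH] l c Y.
  have [Y0|Y0] := pselect (Y [::]).
    rewrite (_ : _ `&` _ = cell l c); first exact: measurable_cell.
    by apply/seteqP; split => t // [].
  by rewrite (_ : _ `&` _ = set0) //; apply/seteqP; split => t // [_ /Y0].
rewrite (_ : _ `&` _ = \bigcup_(j in [set: 'I_q])
  (cell (l + offset c j) (c + munit j) `&`
   word n (l + offset c j) (c + munit j) @^-1` [set x | Y (j :: x)])).
  by apply: fin_bigcup_measurable => // j _; exact: IH.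
rewrite cell_cover setI_bigcupl; apply: eq_bigcupr => j _.
by apply/seteqP; split => t [tj Yt]; split => //;
  have E := word_letter n tj; move: Yt; rewrite /preimage /= -?E.
Qed.

Lemma measurable_fun_word d (T : measurableType d) n l c (g : seq 'I_q -> T) :
  measurable_fun (cell l c) (fun t => g (word n l c t)).
Proof. by move=> _ Y _; exact: (measurable_word n l c (g @^-1` Y)). Qed.

(** The parameters in [cell l c] whose next [n] letters form [x] fill an interval
    of length [m] at [c] plus the counts of [x]. *)
Lemma integral_word n l c f : (forall x, 0 <= f x) ->
  (\int[lebesgue_measure]_(t in cell l c) (f (word n l c t))%:E =
   (wordsum m n c f)%:E)%E.
Proof.
elim: n l c f => [|n IH] l c f f0.
  rewrite /= (integral_cst _ _ (f [::])%:E); last exact: measurable_cell.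
  rewrite /cell /= lebesgue_measure_itv /= lte_fin ltrDl lt_neqAle m0 andbT.
  have [<-|_] := eqVneq 0 (m c); first by rewrite mule0 mul0r.
  by rewrite -EFinD addrAC subrr add0r -EFinM mulrC.
have cover : cell l c = \big[setU/set0]_(j <- index_enum 'I_q)
    cell (l + offset c j) (c + munit j).
  have enumT : [set` index_enum 'I_q] = [set: 'I_q].
    by apply/seteqP; split=> j // _; rewrite /= mem_index_enum.
  by rewrite cell_cover -bigcup_seq enumT.
have mw : measurable_fun (cell l c) (fun t => (f (word n.+1 l c t))%:E).
  by apply/measurable_EFinP; exact: measurable_fun_word.
rewrite cover in mw *.
rewrite ge0_integral_bigsetU //=; first last.
- by move=> t _; rewrite lee_fin.
- exact: cell_trivIset.
- exact: index_enum_uniq.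
- by move=> j; exact: measurable_cell.
rewrite -sumEFin; apply: eq_bigr => j _.
rewrite -(IH (l + offset c j)) //; apply: eq_integral => t; rewrite inE => tj.
by rewrite -(word_letter n tj).
Qed.

End Coding.

(** * Almost sure convergence and Borel sets of row vectors *)

Section AlmostEverywhere.

(** The sum of the bounds [h k] has a finite integral, hence is finite almost
    everywhere, and there the increments of [u] are absolutely summable. *)
Lemma ae_cvgn_summable d (T : measurableType d) (R : realType)
    (mu : {measure set T -> \bar R}) (D : set T) (u h : nat -> T -> R) :
  measurable D -> (forall k, measurable_fun D (h k)) ->
  (forall k t, D t -> `|u k.+1 t - u k t| <= h k t) ->
  (\sum_(k <oo) \int[mu]_(t in D) (h k t)%:E < +oo)%E ->
  {ae mu, forall t, D t -> cvgn (u^~ t)}.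
Proof.
move=> mD mh uh; have h0 k t : D t -> 0 <= h k t.
  by move=> Dt; exact: le_trans (uh k t Dt).
have mhE k : measurable_fun D (fun t => (h k t)%:E) by exact/measurable_EFinP.
rewrite -integral_nneseries // => hfin.
have msum : measurable_fun D (fun t => \sum_(k <oo) (h k t)%:E)%E.
  by apply: ge0_emeasurable_sum => // k t Dt _; rewrite lee_fin h0.
have hint : mu.-integrable D (fun t => \sum_(k <oo) (h k t)%:E)%E.
  apply/integrableP; split => //.
  under eq_integral => t tD.
    rewrite gee0_abs; last first.
      by apply: nneseries_ge0 => k _ _; rewrite lee_fin h0 //; rewrite inE in tD.
    over.
  exact: hfin.
apply: filterS (integrable_ae mD hint) => t hD Dt.
have {hD}fin := hD Dt.
have ch : cvgn (series (h^~ t)).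
  apply: nondecreasing_is_cvgn.
    by apply: nondecreasing_series => k _ _; exact: h0.
  exists (fine (\sum_(k <oo) (h k t)%:E)%E) => _ [n _ <-].
  rewrite -lee_fin fineK //= /series /= -sumEFin.
  by apply: nneseries_lim_ge => k _ _; rewrite lee_fin h0.
have : cvgn (series (telescope (u^~ t))).
  apply: normed_cvg; apply: series_le_cvg ch => k /=.
  - exact: normr_ge0.
  - exact: h0.
  - exact: uh.
rewrite telescopeK => cu.
rewrite (_ : u^~ t = [sequence u n t - u 0%N t]_n \+ cst (u 0%N t)).
  by apply: is_cvgD => //; exact: is_cvg_cst.
by apply/funext => n /=; rewrite subrK.
Qed.

Lemma ae_forall_fin d (T : measurableType d) (R : realType)
    (mu : {measure set T -> \bar R}) (D : set T) (I : finType)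
    (P : I -> T -> Prop) : (forall i, {ae mu, forall t, D t -> P i t}) ->
  {ae mu, forall t, D t -> forall i, P i t}.
Proof.
move=> /filter_forall; apply: filterS => t h Dt i; exact: h.
Qed.

End AlmostEverywhere.

Section MatrixBorel.
Variables (R : realType) (q : nat).

Lemma continuous_measurable_rV (f : 'rV[R]_q -> R) : continuous f ->
  measurable_fun setT (f : borel_rV R q -> R).
Proof.
move=> /continuousP cf; apply: (measurability _ (RGenOpens.measurableE R)).
move=> _ [_ [a [b ->] <-]]; rewrite setTI.
by apply: sub_sigma_algebra; apply: cf; exact: interval_open.
Qed.

Lemma open_ball_rV (U : set 'rV[R]_q) u : open U -> U u ->
  exists2 e : R, 0 < e & forall v : 'rV[R]_q, (forall j, `|u 0 j - v 0 j| < e) -> U v.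
Proof.
move=> oU Uu; have /nbhs_ballP[e e0 eU] := open_nbhs_nbhs (conj oU Uu).
exists e => // v uv; apply: eU; split => // i j.
by rewrite ord1 -ball_normE /=.
Qed.

(** The limit lies in an open set [U] if and only if, for some margin
    [k.+1%:R^-1], all late terms of the sequence keep that margin inside [U]. The
    terms pull back arbitrary sets to measurable sets, in particular the points
    with a given margin. *)
Lemma measurable_fun_lim_rV d (T : measurableType d) (h : nat -> T -> 'rV[R]_q)
    (F : T -> 'rV[R]_q) :
  (forall k (Y : set 'rV[R]_q), measurable (h k @^-1` Y)) ->
  (forall t j, h k t 0 j @[k --> \oo] --> F t 0 j) ->
  measurable_fun setT (F : T -> borel_rV R q).
Proof.
move=> mh hF.
apply: (measurability _
  (erefl : @measurable _ (borel_rV R q) = <<s @open 'rV[R]_q >>)).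
move=> _ [U oU <-]; rewrite setTI.
pose near_in k : set 'rV[R]_q :=
  [set v : 'rV[R]_q | forall w : 'rV[R]_q,
    (forall j, `|v 0 j - w 0 j| < k.+1%:R^-1) -> U w].
rewrite (_ : F @^-1` U = \bigcup_k \bigcup_N \bigcap_(n in [set n | (N <= n)%N])
    (h n @^-1` near_in k)); last first.
  apply/seteqP; split => t /=.
    move=> /(open_ball_rV oU)[e e0 eU].
    have e20 : 0 < e / 2 by rewrite divr_gt0.
    have [k _ /(_ k (leqnn _)) /= ke] := near_infty_natSinv_lt (PosNum e20).
    have [N _ hN] : \forall n \near \oo, forall j, `|F t 0 j - h n t 0 j| < e / 2.
      apply: filter_forall => j.
      by have /cvgrPdist_lt/(_ _ e20) := hF t j.
    exists k => //; exists N => // n Nn w hw; apply: eU => j.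
    rewrite (splitr e) (le_lt_trans (ler_distD (h n t 0 j) _ _)) // ltrD //.
      exact: hN.
    by rewrite (lt_trans (hw j)).
  move=> [k _ [N _ hN]].
  have k0 : (0 : R) < k.+1%:R^-1 by rewrite invr_gt0.
  have [M _ hM] : \forall n \near \oo, forall j, `|F t 0 j - h n t 0 j| < k.+1%:R^-1.
    apply: filter_forall => j.
    by have /cvgrPdist_lt/(_ _ k0) := hF t j.
  apply: (hN (maxn N M)); first by rewrite /= leq_maxl.
  by move=> j; rewrite distrC; apply: hM; rewrite /= leq_maxr.
apply: bigcupT_measurable => k; apply: bigcupT_measurable => N.
by apply: bigcap_measurable => [|n _]; [exists N => /=|exact: mh].
Qed.

End MatrixBorel.

(** * Monomials on the simplex *)

Section Monomials.
Variables (R : realType) (q : nat).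
Implicit Types (u v : 'rV[R]_q) (a : mindex q).

Lemma monomD a c u : monom (a + c) u = monom a u * monom c u.
Proof.
rewrite /monom -big_split; apply: eq_bigr => j _.
by rewrite maddE exprD.
Qed.

Lemma monom0 u : monom 0 u = 1.
Proof. by rewrite /monom big1 // => j _; rewrite ffunE expr0. Qed.

Lemma monom_unit j u : monom (munit j) u = u 0 j.
Proof.
rewrite /monom (bigD1 j) //= munitE eqxx expr1 big1 ?mulr1 // => i /negbTE ij.
by rewrite munitE ij.
Qed.

Lemma monomS a u : simplex R q u -> monom a u = \sum_j monom (a + munit j) u.
Proof.
move=> [_ u1]; under eq_bigr do rewrite monomD monom_unit.
by rewrite -mulr_sumr u1 mulr1.
Qed.

Lemma monom_ge0 a u : simplex R q u -> 0 <= monom a u.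
Proof.
by move=> [u01 _]; apply: prodr_ge0 => j _; rewrite exprn_ge0 //; case/andP: (u01 j).
Qed.

Lemma monom_le1 a u : simplex R q u -> monom a u <= 1.
Proof.
move=> [u01 _]; apply: prodr_ile1 => j _.
have /andP[u0 u1] := u01 j.
by rewrite exprn_ge0 //= exprn_ile1.
Qed.

End Monomials.

Lemma continuous_monom (R : realType) (q : nat) (a : mindex q) :
  continuous (@monom R q a).
Proof.
move=> u; rewrite /continuous_at /monom; apply: cvg_big => [||j _].
- exact: mul_continuous.
- exact: (nbhs_filter (u : 'rV[R]_q)).
have /= c := @continuous_comp _ _ _ (fun u : 'rV[R]_q => u 0 j) (fun x => x ^+ a j) u.
by apply: c; [exact: coord_continuous|exact: exprn_continuous].
Qed.

(** * A representing measure for the moment recursion *)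

(** A weighted form of the inequality between arithmetic and geometric means; it
    bounds a first moment by a second moment when [p] is the inverse of the
    expected order of magnitude of [d]. *)
Lemma norm_le_weighted_sqr (R : realFieldType) (p d : R) : 0 < p ->
  `|d| <= p * d ^+ 2 + p^-1.
Proof.
move=> p0; rewrite -[X in _ * X]real_normK ?num_real //; set y := `|d|.
have y0 : 0 <= y by exact: normr_ge0.
have key : 0 <= p^-1 * ((p * y - 1) ^+ 2 + p * y).
  by rewrite mulr_ge0 ?invr_ge0 ?(ltW p0) // addr_ge0 ?sqr_ge0 // mulr_ge0 // ltW.
rewrite -subr_ge0 (_ : p * y ^+ 2 + p^-1 - y = p^-1 * ((p * y - 1) ^+ 2 + p * y)).
  exact: key.
by field; rewrite gt_eqF.
Qed.

Lemma sum_count_mem (q : nat) (x : seq 'I_q) : (\sum_j count_mem j x)%N = size x.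
Proof.
elim: x => [|i x IH] /=; first by rewrite big1.
rewrite big_split /= IH (bigD1 i) //= eqxx big1 ?addn0 ?add1n // => j ji.
by rewrite eq_sym (negbTE ji).
Qed.

Lemma ffact_le_exp n k : (n ^_ k <= n ^ k)%N.
Proof.
elim: k => // k IH; rewrite ffactnSr expnSr; exact: leq_mul IH (leq_subr _ _).
Qed.

Lemma ffact_prod_le (q : nat) (a : mindex q) x : (ffact_prod a x <= size x ^ mdeg a)%N.
Proof.
rewrite /ffact_prod /mdeg expn_sum; apply: leq_prod => j _.
apply: leq_trans (ffact_le_exp _ _) _.
by have [->|aj] := posnP (a j); rewrite ?expn0 // leq_exp2r ?count_size.
Qed.

(** For fixed [k], each of the [k] factors [c n - i] is equivalent to [c n]. *)
Lemma cvg_ffact (R : realType) (c N : nat -> nat) (x : R) k :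
  (N n)%:R^-1 @[n --> \oo] --> (0 : R) ->
  (c n)%:R / (N n)%:R @[n --> \oo] --> x ->
  ((c n) ^_ k)%:R / (N n)%:R ^+ k @[n --> \oo] --> x ^+ k.
Proof.
move=> N0 cx; elim: k => [|k IH].
  under eq_fun do rewrite ffactn0 expr0 divr1.
  by rewrite expr0; exact: cvg_cst.
rewrite exprSr (_ : (fun n => _) = (fun n => (((c n) ^_ k)%:R / (N n)%:R ^+ k) *
    ((c n)%:R / (N n)%:R - k%:R * (N n)%:R^-1))).
  apply: cvgM => //; rewrite -[x]subr0; apply: cvgB => //.
  by rewrite -(mulr0 k%:R); apply: cvgM => //; exact: cvg_cst.
apply/funext => n; rewrite ffactnSr exprSr invfM -mulrBl mulrACA; congr (_ * _).
have [ck|kc] := ltnP (c n) k; first by rewrite ffact_small // !mul0r.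
by rewrite natrM natrB.
Qed.

Section Existence.
Variables (R : realType) (q : nat) (m : mindex q -> R) (j0 : 'I_q).
Hypotheses (m_ge0 : forall d, 0 <= m d) (m0 : m 0 = 1)
  (mS : forall d, m d = \sum_j m (d + munit j)).

Let X n (t : R) : seq 'I_q := word m j0 n 0 0 t.
Let D : set R := cell m 0 0.
Local Notation mu := (@lebesgue_measure R).

Lemma unit_moment_le1 j : m (munit j) <= 1.
Proof.
by rewrite -m0 [leRHS]mS (bigD1 j) //= add0r lerDl sumr_ge0.
Qed.

Lemma cell_unit : D = `[0, 1[%classic.
Proof. by rewrite /D /cell m0 add0r. Qed.

(** Between the lengths [4 ^ k] and [4 ^ k.+1] the mean square increment of the
    frequency is at most [4 ^- k]; weighted by [2 ^+ k] it is still summable. *)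
Lemma ae_cvg_freq (j : 'I_q) :
  {ae mu, forall t, D t -> cvgn (fun k => freq R (4 ^ k) (X (4 ^ k) t) j)}.
Proof.
pose f k (x : seq 'I_q) : R :=
  2 ^+ k * (freq R (4 ^ k.+1) x j - freq R (4 ^ k) (take (4 ^ k) x) j) ^+ 2
    + 2 ^- k.
have E4 k : (4 ^ k.+1 = 4 ^ k + 3 * 4 ^ k)%N by rewrite expnS mulSn.
have takeX k t : take (4 ^ k) (X (4 ^ k.+1) t) = X (4 ^ k) t.
  by rewrite /X E4 take_word.
have p2 k : 0 < (2 : R) ^+ k by rewrite exprn_gt0.
have f0 k x : 0 <= f k x.
  rewrite /f addr_ge0 ?invr_ge0 ?(ltW (p2 k)) //.
  by rewrite mulr_ge0 ?sqr_ge0 ?(ltW (p2 k)).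
apply: (@ae_cvgn_summable _ _ _ mu D _ (fun k t => f k (X (4 ^ k.+1) t))).
- exact: measurable_cell.
- by move=> k; exact: measurable_fun_word.
- by move=> k t _; rewrite /f takeX; exact: norm_le_weighted_sqr.
(* The integrals are at most 2 * 2 ^- k, the terms of a geometric series of sum 4. *)
apply: le_lt_trans (ltry (4 : R)).
have e40 : (0 : R) <= 4 by exact: ler0n.
apply: le_trans (epsilon_trick0 xpredT e40).
apply: lee_nneseries => [k _ _|k _].
  by apply: integral_ge0 => t _; rewrite lee_fin.
rewrite integral_word // lee_fin.
rewrite /f wordsumD wordsumZ wordsum_cst // m0 mul1r.
have := wordsum_freq_cauchy mS m_ge0 (3 * 4 ^ k) 0 j (n := 4 ^ k).
rewrite expn_gt0 -E4 => /(_ isT); rewrite add0r => h.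
have {}h := le_trans h (ler_wpM2r _ (unit_moment_le1 j)).
have e4 : (4 : R) = 2 * 2 by rewrite -natrM.
have p4 : (2 : R) ^+ k * ((4 ^ k)%:R)^-1 = 2 ^- k.
  by rewrite natrX e4 exprMn invfM mulrA mulfV ?mul1r //.
apply: (@le_trans _ _ (2 ^+ k * (1 * ((4 ^ k)%:R)^-1) + 2 ^- k)).
  by rewrite lerD2r ler_wpM2l ?(ltW (p2 k)) // h // invr_ge0 ler0n.
rewrite mul1r p4 natrX exprS invfM e4.
rewrite mulrA mulfK ?pnatr_eq0 //.
by rewrite mulr_natl mulr2n.
Qed.

Lemma row_freq_simplex n (x : seq 'I_q) : (0 < n)%N -> size x = n ->
  simplex R q (row_freq n x).
Proof.
move=> n0 xn; have n0R : (0 : R) < n%:R by rewrite ltr0n.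
split=> [j|].
  rewrite mxE /freq divr_ge0 //= ler_pdivrMr // mul1r ler_nat -xn.
  exact: count_size.
under eq_bigr do rewrite mxE.
by rewrite -mulr_suml -natr_sum sum_count_mem xn divff // gt_eqF.
Qed.

Lemma simplex_lim (h : nat -> 'rV[R]_q) (u : 'rV[R]_q) :
  (forall k, simplex R q (h k)) -> (forall j, h k 0 j @[k --> \oo] --> u 0 j) ->
  simplex R q u.
Proof.
move=> hs hu; split=> [j|].
  have clo : closed (`[0, 1]%classic : set R) by exact: interval_closed.
  suff : (`[0, 1]%classic : set R) (u 0 j) by rewrite /= in_itv.
  apply: (closed_cvg _ clo _ _ (hu j)); apply: nearW => k.
  by rewrite /= in_itv /=; have [+ _] := hs k; exact.
have c1 : \sum_j h k 0 j @[k --> \oo] --> \sum_j u 0 j.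
  by apply: cvg_big => //; exact: add_continuous.
have c2 : \sum_j h k 0 j @[k --> \oo] --> (1 : R).
  rewrite (_ : (fun k => _) = cst 1); first exact: cvg_cst.
  by apply/funext => k; have [] := hs k.
exact: (cvg_unique _ c1 c2).
Qed.

Lemma inv_exp4_cvg0 : ((4 ^ k)%N%:R)^-1 @[k --> \oo] --> (0 : R).
Proof.
under eq_fun do rewrite natrX -exprVn.
by apply: cvg_expr; rewrite ger0_norm ?invr_ge0 // invf_lt1 // ltr1n.
Qed.

(** De Finetti's theorem in moment form: the measure is the law of the limit of
    the colour frequencies of the random word. *)
Theorem exists_representing_measure :
  exists nu : probability (borel_rV R q) R,
    on_simplex nu /\ forall a, moment nu a = m a.
Proof.
have [N [mN N0 badN]] : {ae mu, forall t, D t -> forall j,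
    cvgn (fun k => freq R (4 ^ k) (X (4 ^ k) t) j)}.
  by apply: ae_forall_fin; exact: ae_cvg_freq.
have mD : measurable D by exact: measurable_cell.
pose E := D `\` N.
have mE : measurable E by exact: measurableD.
(* On the null set the sequence is replaced by a vertex of the simplex. *)
pose u0 : 'rV[R]_q := row_freq 1 [:: j0].
pose h k t := if t \in E then row_freq (4 ^ k) (X (4 ^ k) t) else u0.
pose F t : 'rV[R]_q := \row_j limn (fun k => h k t 0 j).
have hF t j : h k t 0 j @[k --> \oo] --> F t 0 j.
  rewrite mxE; have [tE|tE] := boolP (t \in E); last first.
    rewrite (_ : (fun k => h k t 0 j) = cst (u0 0 j)).
      by rewrite lim_cst //; exact: cvg_cst.
    by apply/funext => k; rewrite /h (negbTE tE).
  rewrite (_ : (fun k => h k t 0 j) = (fun k => freq R (4 ^ k) (X (4 ^ k) t) j));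
    last by apply/funext => k; rewrite /h tE mxE.
  have [Dt Nt] : E t by rewrite inE in tE.
  have : ~ (~ (D t -> forall j, cvgn (fun k => freq R (4 ^ k) (X (4 ^ k) t) j))).
    by move=> /badN.
  by move=> /contrapT/(_ Dt j).
have hs k t : simplex R q (h k t).
  rewrite /h; case: ifP => _; apply: row_freq_simplex => //.
    by rewrite expn_gt0.
  exact: size_word.
have Fs t : simplex R q (F t) by exact: simplex_lim (hs^~ t) (hF t).
have mF : measurable_fun setT (F : measurableTypeR R -> borel_rV R q).
  apply: measurable_fun_lim_rV hF => k Y.
  rewrite (_ : _ @^-1` _ = (E `&` (D `&` X (4 ^ k) @^-1` (row_freq (4 ^ k) @^-1` Y)))
      `|` (~` E `&` [set t | Y u0])).
    apply: measurableU; apply: measurableI => //.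
    - exact: measurable_word.
    - exact: measurableC.
    have [Yu|Yu] := pselect (Y u0).
      by rewrite (_ : [set _ | _] = setT) //; apply/seteqP; split.
    by rewrite (_ : [set _ | _] = set0) //; apply/seteqP; split.
  apply/seteqP; split => t /=; rewrite /h.
    case: ifPn; rewrite ?inE ?notin_setE => tE Yt; last by right.
    by left; split => //; split => //; case: tE.
  by case=> [[tE [_ Yt]]|[tE Yt]]; [rewrite mem_set|rewrite memNset].
pose mixin := isMeasurableFun.Build _ _ _ _ _ mF.
pose Fp : {mfun measurableTypeR R >-> borel_rV R q} := HB.pack F mixin.
pose P01 : probability (measurableTypeR R) R := uniform_prob (@ltr01 R).
have Fsimplex : F @^-1` simplex R q = setT.
  by apply/seteqP; split => // t _; exact: Fs.
exists (distribution P01 Fp); split.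
  rewrite /on_simplex /distribution /pushforward /=.
  by rewrite Fsimplex probability_setT.
move=> a; rewrite /moment /Rintegral.
have mmon : measurable_fun setT (monom a : borel_rV R q -> R).
  by apply: continuous_measurable_rV; exact: continuous_monom.
have mmonF : measurable_fun setT (fun t => monom a (F t)).
  exact: measurableT_comp mmon mF.
rewrite ge0_integral_pushforward //; first last.
- by move=> u; rewrite inE lee_fin; exact: monom_ge0.
- by apply/measurable_EFinP; exact: measurable_funTS.
- exact: measurable_simplex.
rewrite Fsimplex integral_uniform //; first last.
- by move=> t; rewrite lee_fin; exact: monom_ge0.
- exact/measurable_EFinP.
(* The uniform law charges [0, 1], whose right endpoint is null. *)
rewrite subr0 invr1 mul1e -integral_itv_bndo_bndc; last first.
  by apply/measurable_EFinP; exact: measurable_funTS.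
rewrite -cell_unit.
(* A substitute for the monomial of the frequencies, with an exact integral. *)
pose f k x : R := (ffact_prod a x)%:R / (4 ^ k)%:R ^+ mdeg a.
have f0 k x : 0 <= f k x by rewrite divr_ge0 // exprn_ge0.
pose H k t : R := f k (X (4 ^ k) t).
have HI k : (\int[mu]_(t in D) (H k t)%:E =
    (((4 ^ k) ^_ (mdeg a))%:R / (4 ^ k)%:R ^+ mdeg a * m a)%:E)%E.
  rewrite integral_word //.
  rewrite (eq_wordsum (fun x => (4 ^ k)%:R ^- mdeg a * (ffact_prod a x)%:R));
    last first.
    by move=> x _; rewrite mulrC.
  by rewrite wordsumZ wordsum_ffact_prod // add0r mulrA; congr (_ * _)%:E; exact: mulrC.
have Hcvg t : D t -> ~ N t -> H k t @[k --> \oo] --> monom a (F t).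
  move=> Dt Nt; have tE : t \in E by rewrite inE.
  rewrite (_ : (fun k => H k t) = (fun k => \prod_j
      ((count_mem j (X (4 ^ k) t) ^_ (a j))%:R / (4 ^ k)%:R ^+ a j))).
    apply: cvg_big => [|j _]; first exact: mul_continuous.
    apply: (@cvg_ffact R (fun k => count_mem j (X (4 ^ k) t)) (fun k => 4 ^ k)%N).
      exact: inv_exp4_cvg0.
    have := hF t j; rewrite (_ : (fun k => h k t 0 j) =
       (fun k => (count_mem j (X (4 ^ k) t))%:R / (4 ^ k)%:R)) //.
    by apply/funext => k; rewrite /h tE mxE.
  by apply/funext => k; rewrite prodf_div /H /f natr_prod prodrXr.
have mH k : measurable_fun D (H k) by exact: measurable_fun_word.
have [|||||_ _ cv] := @dominated_convergence _ _ R mu D mD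
  (fun k t => (H k t)%:E) (fun t => (monom a (F t))%:E) (cst 1%:E).
- by move=> k; apply/measurable_EFinP; exact: mH.
- by apply/measurable_EFinP; exact: measurable_funTS.
- exists N; split => // t /= ht; apply: contrapT => Nt; apply: ht => Dt.
  by apply: cvg_EFin; [exact: nearW|exact: Hcvg].
- apply/integrableP; split; first exact: measurable_cst.
  rewrite (eq_integral (cst 1%:E)); last by move=> t _ /=; rewrite normr1.
  by rewrite integral_cst //= mul1e cell_unit lebesgue_measure_itv /= lte_fin ltr01 ltry.
- apply: nearW => t k _; rewrite lee_fin ger0_norm; last exact: f0.
  rewrite /H /f ler_pdivrMr ?mul1r ?exprn_gt0 ?ltr0n ?expn_gt0 //.
  rewrite -natrX ler_nat; apply: leq_trans (ffact_prod_le _ _) _.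
  by rewrite size_word.
have cv' : (\int[mu]_(t in D) (H k t)%:E)%E @[k --> \oo] --> (m a)%:E.
  under eq_fun do rewrite HI.
  apply: cvg_EFin; first exact: nearW.
  rewrite -[X in _ --> X]mul1r; apply: cvgM; last exact: cvg_cst.
  suff c1 : (4 ^ k)%N%:R / (4 ^ k)%N%:R @[k --> \oo] --> (1 : R).
    have := @cvg_ffact R (fun k => 4 ^ k)%N (fun k => 4 ^ k)%N 1 (mdeg a) inv_exp4_cvg0 c1.
    by rewrite expr1n.
  rewrite (_ : (fun k => _) = cst 1); first exact: cvg_cst.
  by apply/funext => k; rewrite divff // pnatr_eq0 expn_eq0.
have -> : (\int[mu]_(x in D) ((fun x => (monom a x)%:E) \o F) x = (m a)%:E)%E.
  exact: (cvg_unique _ cv cv').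
by [].
Qed.

End Existence.

(** * Uniqueness of the representing measure *)

Section BernsteinApproximation.
Variables (R : realType) (q : nat).
Implicit Types (u v : 'rV[R]_q) (a : mindex q).

Definition l1dist u v : R := \sum_j `|u 0 j - v 0 j|.

(** The weights [monom a u] describe independent letters with law [u], and the
    left hand side is the variance of a binomial frequency. *)
Lemma wordsum_freq_variance n j u : simplex R q u -> (0 < n)%N ->
  wordsum (@monom R q ^~ u) n 0 (fun x => (freq R n x j - u 0 j) ^+ 2) <= n%:R^-1.
Proof.
move=> us n0; have mS d := monomS d us.
rewrite (eq_wordsum (fun x => n%:R ^- 2 * (count_mem j x)%:R ^+ 2 +
   ((- 2 * u 0 j / n%:R) * (count_mem j x)%:R + u 0 j ^+ 2))); last first.
  by move=> x _; rewrite /freq; field; rewrite pnatr_eq0 -lt0n.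
rewrite wordsumD wordsumZ wordsumD wordsumZ.
rewrite wordsum_cst // wordsum_count // wordsum_count2 //.
rewrite !add0r !monomD monom0 !monom_unit mul1r.
have [/(_ j)/andP[u0 u1] _] := us.
set y := u 0 j in u0 u1 *; have n0R : (0 : R) < n%:R by rewrite ltr0n.
rewrite [X in X <= _](_ : _ = (y - y ^+ 2) / n%:R).
  rewrite ler_pdivrMr // mulVf ?gt_eqF //; have := sqr_ge0 y; lra.
have -> : (n * n.-1)%:R = n%:R ^+ 2 - n%:R :> R.
  by case: n n0 {n0R} => // n _; rewrite /= natrM -[n.+1]addn1 natrD; ring.
by field; rewrite gt_eqF.
Qed.

(** The sum is the Bernstein polynomial of [g] of degree [4 ^ k] on the simplex,
    written as the expectation of [g] at the frequencies of independent letters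
    of law [u]; the frequencies deviate from [u] by about [2 ^- k]. *)
Lemma bernstein_approx (g : 'rV[R]_q -> R) (K : R) k u : 0 <= K ->
  (forall v w, `|g v - g w| <= K * l1dist v w) -> simplex R q u ->
  `|wordsum (@monom R q ^~ u) (4 ^ k) 0 (fun x => g (row_freq (4 ^ k) x)) - g u|
    <= K * q%:R * 2 * 2 ^- k.
Proof.
move=> K0 gL us; have mS d := monomS d us; have m0 d := monom_ge0 d us.
set n := (4 ^ k)%N; have n0 : (0 < n)%N by rewrite expn_gt0.
(* The standard deviation of a frequency over n letters is at most p^-1. *)
pose p : R := 2 ^+ k; have p0 : 0 < p by rewrite exprn_gt0.
have np : n%:R = p ^+ 2.
  by rewrite /n /p -exprM mulnC exprM natrX -[2 ^+ 2]natrX.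
pose bound (x : seq 'I_q) : R :=
  K * \sum_j (p * (freq R n x j - u 0 j) ^+ 2 + p^-1).
have gb x : `|g (row_freq n x) - g u| <= bound x.
  apply: le_trans (gL _ _) _; rewrite ler_wpM2l //; apply: ler_sum => j _.
  by rewrite mxE; exact: norm_le_weighted_sqr.
have cg c : wordsum (@monom R q ^~ u) n 0 (fun=> c) = c.
  by rewrite wordsum_cst // monom0 mul1r.
have Eb : wordsum (@monom R q ^~ u) n 0 bound <= K * q%:R * 2 * 2 ^- k.
  rewrite wordsumZ wordsum_sum -!mulrA ler_wpM2l //.
  rewrite mulr_natl -[X in _ *+ X](card_ord q) -sumr_const; apply: ler_sum => j _.
  rewrite wordsumD wordsumZ cg -/p mulr2n mulrDl mul1r lerD2r.
  apply: le_trans (ler_wpM2l (ltW p0) (wordsum_freq_variance j us n0)) _.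
  by rewrite np expr2 invfM mulrA divff ?mul1r // gt_eqF.
apply: le_trans Eb; rewrite ler_norml -[g u]cg; apply/andP; split.
  rewrite lerBrDr [X in X <= _]addrC lerBlDr -wordsumD.
  by apply: wordsum_le => // x _; have := gb x; rewrite ler_norml; lra.
rewrite lerBlDr -wordsumD.
by apply: wordsum_le => // x _; have := gb x; rewrite ler_norml; lra.
Qed.

End BernsteinApproximation.

Section OuterApproximation.
Variables (R : realType) (q : nat) (U : set 'rV[R]_q).
Implicit Types (u v w : 'rV[R]_q).

Lemma l1dist_ge0 u v : 0 <= l1dist u v.
Proof. by apply: sumr_ge0. Qed.

Lemma l1dist_triangle v u w : l1dist u w <= l1dist u v + l1dist v w.
Proof. by rewrite -big_split; apply: ler_sum => j _; exact: ler_distD. Qed.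

Lemma l1distC u v : l1dist u v = l1dist v u.
Proof. by apply: eq_bigr => j _; rewrite distrC. Qed.

Lemma l1distuu u : l1dist u u = 0.
Proof. by rewrite /l1dist big1 // => j _; rewrite subrr normr0. Qed.

(** The largest [k]-Lipschitz function below the indicator of [U], for the norm
    underlying [l1dist]. *)
Definition lip_indic (k : nat) u : R :=
  inf [set (v \in U)%:R + k%:R * l1dist u v | v in [set: 'rV[R]_q]].

Let lb0 k u : lbound [set (v \in U)%:R + k%:R * l1dist u v | v in [set: 'rV[R]_q]] 0.
Proof. by move=> _ [v _ <-]; rewrite addr_ge0 // mulr_ge0 // l1dist_ge0. Qed.

Lemma lip_indic_le k u v : lip_indic k u <= (v \in U)%:R + k%:R * l1dist u v.
Proof.
by apply: ge_inf; [exists 0; exact: lb0|exists v].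
Qed.

Lemma lip_indic_ge k u (x : R) :
  (forall v, x <= (v \in U)%:R + k%:R * l1dist u v) -> x <= lip_indic k u.
Proof.
move=> h; apply: lb_le_inf; first by exists ((u \in U)%:R + k%:R * l1dist u u), u.
by move=> _ [v _ <-].
Qed.

Lemma lip_indic_ge0 k u : 0 <= lip_indic k u.
Proof. by apply: lip_indic_ge => v; rewrite addr_ge0 // mulr_ge0 // l1dist_ge0. Qed.

Lemma lip_indic_le_indic k u : lip_indic k u <= (u \in U)%:R.
Proof. by apply: le_trans (lip_indic_le k u u) _; rewrite l1distuu mulr0 addr0. Qed.

Lemma lip_indic_lipschitz k u w : `|lip_indic k u - lip_indic k w| <= k%:R * l1dist u w.
Proof.
have half x y : lip_indic k x - lip_indic k y <= k%:R * l1dist x y.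
  rewrite lerBlDr -lerBlDl; apply: lip_indic_ge => v.
  rewrite lerBlDl; apply: le_trans (lip_indic_le k x v) _.
  by rewrite addrCA lerD2l -mulrDr ler_wpM2l // l1dist_triangle.
by rewrite ler_norml half lerNl opprB l1distC half.
Qed.

(** A point of an open [U] is at a positive distance [e] from the complement, and
    the penalty [k%:R * l1dist u v] exceeds 1 there as soon as [e^-1 <= k]. *)
Lemma lip_indic_cvg u : open U -> lip_indic k u @[k --> \oo] --> ((u \in U)%:R : R).
Proof.
move=> oU; have [uU|uU] := boolP (u \in U); last first.
  rewrite (_ : lip_indic^~ u = cst 0); first exact: cvg_cst.
  apply/funext => k; apply/le_anti; rewrite lip_indic_ge0 andbT.
  by have := lip_indic_le_indic k u; rewrite (negbTE uU).
have /(open_ball_rV oU)[e e0 eU] : U u by rewrite inE in uU.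
apply: cvg_near_cst; near=> k.
apply/le_anti/andP; split; first by have := lip_indic_le_indic k u; rewrite uU.
apply: lip_indic_ge => v; have [vU|vU] := boolP (v \in U).
  by rewrite lerDl mulr_ge0 // l1dist_ge0.
have [j ej] : exists j, e <= `|u 0 j - v 0 j|.
  apply: contrapT => h; move/negP: vU; apply; rewrite inE; apply: eU => j.
  by rewrite ltNge; apply/negP => ?; apply: h; exists j.
rewrite add0r; apply: (@le_trans _ _ (k%:R * e)); last first.
  rewrite ler_wpM2l // (le_trans ej) // /l1dist (bigD1 j) //= lerDl.
  exact: sumr_ge0.
rewrite -ler_pdivrMr // div1r; near: k; exact: nbhs_infty_ger.
Unshelve. all: by end_near. Qed.

End OuterApproximation.

Lemma lipschitz_continuous (R : realType) (q : nat) (g : 'rV[R]_q -> R) (K : R) :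
  0 <= K -> (forall v w, `|g v - g w| <= K * l1dist v w) -> continuous g.
Proof.
move=> K0 gL u.
apply: ((@cvgrPdist_lt _ _ _ _ (nbhs_filter (u : 'rV[R]_q)) _ _).2) => e e0.
(* The shifts by 1 keep the denominators positive when K = 0 or q = 0. *)
have d0 : 0 < e / (K + 1) / q.+1%:R by rewrite !divr_gt0 // ltr_wpDl.
have hd : \forall v \near (u : 'rV[R]_q), forall j : 'I_q,
    `|u 0 j - (v : 'rV[R]_q) 0 j| < e / (K + 1) / q.+1%:R.
  apply: (@filter_forall _ _ _ _ (nbhs_filter (u : 'rV[R]_q))) => j.
  have c := @coord_continuous R 1 q 0 j u.
  exact: ((@cvgrPdist_lt _ _ _ _ (nbhs_filter (u : 'rV[R]_q)) _ _).1 c).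
apply: (@filterS _ (nbhs u) (nbhs_filter (u : 'rV[R]_q)) _ _ _ hd) => v hv.
apply: le_lt_trans (gL _ _) _.
apply: (@le_lt_trans _ _ (K * (e / (K + 1)))); last first.
  by rewrite mulrCA gtr_pMr // ltr_pdivrMr ?mul1r ?ltrDl // ltr_wpDl.
rewrite ler_wpM2l //.
apply: (@le_trans _ _ (\sum_(j < q) e / (K + 1) / q.+1%:R)).
  by apply: ler_sum => j _; exact/ltW.
rewrite sumr_const card_ord; set y := e / (K + 1).
have y0 : 0 <= y by rewrite divr_ge0 ?ltW // ltr_wpDl.
rewrite -[_ *+ _]mulr_natr -mulrA ler_piMr //.
by rewrite mulrC ler_pdivrMr // mul1r ler_nat.
Qed.

Section Uniqueness.
Variables (R : realType) (q : nat).
Local Notation S := (simplex R q).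
Implicit Types nu : probability (borel_rV R q) R.

Let mS : measurable (S : set (borel_rV R q)) := @measurable_simplex R q.

Lemma measurable_monom a : measurable_fun setT (monom a : borel_rV R q -> R).
Proof. by apply: continuous_measurable_rV; exact: continuous_monom. Qed.

Lemma integral_monom nu a :
  (\int[nu]_(u in S) (monom a u)%:E = (moment nu a)%:E)%E.
Proof.
rewrite /moment /Rintegral fineK // ge0_fin_numE; last first.
  by apply: integral_ge0 => u us; rewrite lee_fin monom_ge0.
apply: (@le_lt_trans _ _ (\int[nu]_(u in S) (cst 1%:E) u)%E).
  apply: ge0_le_integral => //.
  - by move=> u us; rewrite lee_fin monom_ge0.
  - by apply/measurable_EFinP; apply: measurable_funTS; exact: measurable_monom.
  - by move=> u us; rewrite lee_fin monom_le1.
rewrite integral_cst // mul1e; apply: le_lt_trans (ltry (1 : R)).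
exact: probability_le1.
Qed.

Lemma measurable_wordsum_monom n c (f : seq 'I_q -> R) :
  measurable_fun setT (fun u : borel_rV R q => wordsum (@monom R q ^~ u) n c f).
Proof.
elim: n c f => [|n IH] c f /=.
  by apply: measurable_funM => //; exact: measurable_monom.
by apply: measurable_sum => j; exact: IH.
Qed.

Lemma wordsum_monom_ge0 n c (f : seq 'I_q -> R) u : S u -> (forall x, 0 <= f x) ->
  0 <= wordsum (@monom R q ^~ u) n c f.
Proof.
move=> us; elim: n c f => [|n IH] c f f0 /=; first by rewrite mulr_ge0 ?monom_ge0.
by apply: sumr_ge0 => j _; exact: IH.
Qed.

Lemma integral_wordsum nu n c (f : seq 'I_q -> R) : (forall x, 0 <= f x) ->
  (\int[nu]_(u in S) (wordsum (@monom R q ^~ u) n c f)%:E =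
   (wordsum (moment nu) n c f)%:E)%E.
Proof.
elim: n c f => [|n IH] c f f0 /=.
  under eq_integral do rewrite EFinM muleC.
  rewrite ge0_integralZl_EFin //.
  - by rewrite integral_monom -EFinM mulrC.
  - by move=> u us; rewrite lee_fin monom_ge0.
  - by apply/measurable_EFinP; apply: measurable_funTS; exact: measurable_monom.
under eq_integral do rewrite -sumEFin.
rewrite ge0_integral_sum //.
- by rewrite -sumEFin; apply: eq_bigr => j _; exact: IH.
- move=> j; apply/measurable_EFinP; apply: measurable_funTS.
  exact: measurable_wordsum_monom.
- by move=> j u us; rewrite lee_fin wordsum_monom_ge0.
Qed.

Lemma integrable_cst1 nu : nu.-integrable S (cst 1%:E).
Proof.
apply/integrableP; split; first exact: measurable_cst.
rewrite (eq_integral (cst 1%:E)); last by move=> t _ /=; rewrite normr1.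
rewrite integral_cst // mul1e; apply: le_lt_trans (ltry (1 : R)).
exact: probability_le1.
Qed.

(** The integral of a Bernstein polynomial is a combination of moments, so that
    this convergence expresses the integral of [g] through the moments alone. *)
Lemma bernstein_integral_cvg nu (g : 'rV[R]_q -> R) (K : R) : 0 <= K ->
  (forall v w, `|g v - g w| <= K * l1dist v w) -> (forall v, 0 <= g v <= 1) ->
  (wordsum (moment nu) (4 ^ k) 0 (fun x => g (row_freq (4 ^ k) x)))%:E @[k --> \oo]
    --> (\int[nu]_(u in S) (g u)%:E)%E.
Proof.
move=> K0 gL g01; pose f k (x : seq 'I_q) : R := g (row_freq (4 ^ k) x).
have f0 k x : 0 <= f k x by have /andP[] := g01 (row_freq (4 ^ k) x).
have f1 k x : f k x <= 1 by have /andP[] := g01 (row_freq (4 ^ k) x).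
rewrite (_ : (fun k => _) = (fun k =>
  \int[nu]_(u in S) (wordsum (@monom R q ^~ u) (4 ^ k) 0 (f k))%:E)%E); last first.
  by apply/funext => k; rewrite integral_wordsum.
apply: (@dominated_cvg _ _ R nu S mS _ _ (cst 1%:E)).
- move=> k; apply/measurable_EFinP; apply: measurable_funTS.
  exact: measurable_wordsum_monom.
- move=> u us; apply: cvg_EFin; first exact: nearW.
  apply/cvgrPdist_le => e e0.
  have c0 : K * q%:R * 2 * 2 ^- k @[k --> \oo] --> (0 : R).
    rewrite -(mulr0 (K * q%:R * 2)); apply: cvgM; first exact: cvg_cst.
    under eq_fun do rewrite -exprVn.
    by apply: cvg_expr; rewrite ger0_norm ?invr_ge0 // invf_lt1 // ltr1n.
  have /cvgrPdist_le/(_ e e0) := c0; apply: filterS => k /=.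
  rewrite sub0r normrN; set B := K * _ * _ * _ => Be.
  rewrite distrC; apply: le_trans (bernstein_approx k K0 gL us) _.
  exact: le_trans (ler_norm _) Be.
- by move=> u us.
- exact: integrable_cst1.
- move=> k u us; rewrite lee_fin ger0_norm; last exact: wordsum_monom_ge0.
  rewrite -[leRHS](_ : wordsum (@monom R q ^~ u) (4 ^ k) 0 (fun=> 1) = 1).
    by apply: wordsum_le => // d; exact: monom_ge0.
  by rewrite wordsum_cst ?monom0 ?mulr1 // => d; exact: monomS.
Qed.

(** Equal moments give equal integrals of the Lipschitz functions [lip_indic U k],
    whose limits are the measures of the open set [U]; open sets are stable under
    intersection and generate the Borel sets. *)
Theorem eq_measure_of_moments nu nu' : on_simplex nu -> on_simplex nu' ->
  (forall a, moment nu a = moment nu' a) ->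
  forall B : set (borel_rV R q), measurable B -> nu B = nu' B.
Proof.
move=> nuS nuS' mm.
have supp (mu : probability (borel_rV R q) R) (U : set (borel_rV R q)) :
    on_simplex mu -> measurable U -> mu U = mu (U `&` S).
  move=> muS mU; have muC : mu (~` S) = 0%E.
    by rewrite probability_setC // [X in (_ - X)%E]muS -EFinB subrr.
  rewrite -[in LHS](setUIDK U S) measureU; last 3 first.
  - exact: measurableI.
  - exact: measurableD.
  - by apply/seteqP; split => // x [[_ ?] [_ ?]].
  rewrite [X in (_ + X)%E](_ : _ = 0%E) ?adde0 //.
  apply/eqP; rewrite eq_le measure_ge0 andbT -[leRHS]muC.
  apply: le_measure; rewrite ?inE; [exact: measurableD|exact: measurableC|].
  by move=> x [].
have limU (mu : probability (borel_rV R q) R) (U : set 'rV[R]_q) :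
    on_simplex mu -> open U ->
    (\int[mu]_(u in S) (lip_indic U k u)%:E)%E @[k --> \oo] --> mu U.
  move=> muS oU.
  have mU : measurable (U : set (borel_rV R q)) by exact: sub_sigma_algebra.
  rewrite (supp mu) // -integral_indic //.
  apply: (@dominated_cvg _ _ R mu S mS _ _ (cst 1%:E)).
  - move=> k; apply/measurable_EFinP; apply: measurable_funTS.
    apply: continuous_measurable_rV; apply: (@lipschitz_continuous _ _ _ k%:R) => //.
    exact: lip_indic_lipschitz.
  - move=> u us; apply: cvg_EFin; first exact: nearW.
    by rewrite indicE; exact: lip_indic_cvg.
  - by [].
  - exact: integrable_cst1.
  - move=> k u us; rewrite lee_fin ger0_norm ?lip_indic_ge0 //.
    by apply: le_trans (lip_indic_le_indic _ _ _) _; case: (_ \in _).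
apply: (@measure_unique _ R (borel_rV R q) (@open 'rV[R]_q) (fun=> setT)) => //.
- by move=> A B; exact: openI.
- by move=> _; exact: openT.
- by rewrite bigcup_const.
- move=> U oU; have c1 := limU nu U nuS oU.
  suff E k : (\int[nu]_(u in S) (lip_indic U k u)%:E =
      \int[nu']_(u in S) (lip_indic U k u)%:E)%E.
    by have := limU nu' U nuS' oU; under eq_fun do rewrite -E; exact: cvg_unique.
  have k0 : (0 : R) <= k%:R by [].
  have b01 v : 0 <= lip_indic U k v <= 1.
    rewrite lip_indic_ge0 /=; apply: le_trans (lip_indic_le_indic _ _ _) _.
    by case: (_ \in _).
  have d1 := @bernstein_integral_cvg nu _ _ k0 (lip_indic_lipschitz U k) b01.
  have d2 := @bernstein_integral_cvg nu' _ _ k0 (lip_indic_lipschitz U k) b01.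
  have mE : moment nu = moment nu' by exact/funext.
  by rewrite mE in d1; exact: cvg_unique d1 d2.
- by move=> _; apply: le_lt_trans (ltry (1 : R)); exact: probability_le1.
Qed.

End Uniqueness.

(** * Chromatic partitions and the deletion of one unit *)

Section ChromaticPartitions.
Variable q : nat.
Implicit Types (A B : chroms q) (a c r : mindex q) (j : 'I_q).

Lemma msingle_neq0 a : a != 0 -> msingle a = [mset a]%mset.
Proof. by rewrite /msingle => /negbTE ->. Qed.

Lemma msingle0 : msingle (0 : mindex q) = mset0.
Proof. by rewrite /msingle eqxx. Qed.

Definition weight A : nat := \sum_(a <- finsupp A) A a * mdeg a.

Lemma weight_incl A (S : {fset mindex q}) : (finsupp A `<=` S)%fset ->
  weight A = (\sum_(a <- S) A a * mdeg a)%N.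
Proof.
move=> AS; apply: big_fset_incl => // a _; rewrite msuppE => /mset_eq0P ->.
by rewrite mul0n.
Qed.

Lemma finsuppD A B : finsupp (A `+` B)%mset = (finsupp A `|` finsupp B)%fset.
Proof. by apply/fsetP => a; rewrite inE !msuppE in_msetD. Qed.

Lemma weightD A B : weight (A `+` B)%mset = (weight A + weight B)%N.
Proof.
pose S := (finsupp A `|` finsupp B)%fset.
rewrite (@weight_incl _ S) ?finsuppD // (@weight_incl A S) ?fsubsetUl //.
rewrite (@weight_incl B S) ?fsubsetUr // -big_split.
by apply: eq_bigr => a _; rewrite msetE2 mulnDl.
Qed.

Lemma weight0 : weight (mset0 : chroms q) = 0%N.
Proof. by rewrite /weight finsupp0 big_nil. Qed.

Lemma weight_single a : weight (msingle a) = mdeg a.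
Proof.
rewrite /msingle; case: eqVneq => [->|_]; first by rewrite weight0 mdeg0.
by rewrite /weight finsupp_msetn /= big_seq_fset1 msetnxx mul1n.
Qed.

Lemma chrompart0 : chrompart q 0 mset0.
Proof. by split; [rewrite mset0E|exact: weight0]. Qed.

Lemma chrompartD n A r : chrompart q n A ->
  chrompart q (n + mdeg r) (A `+` msingle r)%mset.
Proof.
move=> [A0 An]; split; last by rewrite -/(weight _) weightD weight_single -An.
by rewrite msetE2 A0 msingleE; case: eqVneq => // /negbTE r0; rewrite eq_sym r0.
Qed.

Lemma chrompart_neq0 n A r : chrompart q n A -> r \in A -> r != 0.
Proof. by move=> [A0 _]; apply: contraTneq => ->; apply/mset_eq0P. Qed.

Lemma msingleBK A r : r \in A -> ((A `\` msingle r) `+` msingle r = A)%mset.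
Proof.
rewrite /msingle => rA; case: ifP => _; first by rewrite msetB0 msetD0.
by rewrite msetDC msetB1K.
Qed.

Lemma msingleDK A r : ((A `+` msingle r) `\` msingle r = A)%mset.
Proof. exact: msetDKBC. Qed.

Lemma chrompartB n A r : chrompart q n A -> r \in A ->
  (mdeg r <= n)%N /\ chrompart q (n - mdeg r) (A `\` msingle r)%mset.
Proof.
move=> [A0 An] rA; have := An; rewrite -/(weight A) -{1}(msingleBK rA) weightD.
rewrite weight_single => wn; split; first by rewrite -wn leq_addl.
split; last by rewrite -wn addnK.
by rewrite msetE2 A0.
Qed.

Lemma chrompart0E A : chrompart q 0 A -> A = mset0.
Proof.
move=> A0; have [//|[a aA]] := mset_0Vmem A.
have [] := chrompartB A0 aA; rewrite leqn0 mdeg_eq0 => /eqP a0.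
by have := chrompart_neq0 A0 aA; rewrite a0 eqxx.
Qed.

Lemma msingle_sub A r : r != 0 -> (msingle r `<=` A)%mset = (r \in A).
Proof. by move=> r0; rewrite msingle_neq0 // msub1set. Qed.

Section Lift.
Variable B : chroms q.

(** Adding one unit of colour [j] to a block [c] of [B]; for [c = 0] the unit forms
    a new singleton block. *)
Definition mlift (cj : mindex q * 'I_q) : chroms q :=
  ((B `\` msingle cj.1) `+` msingle (cj.1 + munit cj.2))%mset.

Definition lifts : seq (mindex q * 'I_q) :=
  [seq (c, j) | c <- 0 :: (finsupp B : seq _), j <- enum 'I_q].

Lemma mem_lifts c j : ((c, j) \in lifts) = (c == 0) || (c \in B).
Proof.
apply/allpairsP/idP => [[[c' j'] /= [cB _ [-> _]]]|cB].
  by move: cB; rewrite in_cons msuppE.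
by exists (c, j); split; rewrite ?mem_enum // in_cons msuppE.
Qed.

Lemma madd_unit_neq c j : c + munit j != c.
Proof. by rewrite -{2}(maddK c j) eq_sym mpred_neq // maddE munitE eqxx addn1. Qed.

Lemma mlift_at c j : mlift (c, j) (c + munit j) = (B (c + munit j)).+1.
Proof.
rewrite /mlift /= !msetE2 !msingleE eqxx madd_unit_neq0 (negbTE (madd_unit_neq c j)).
by rewrite andbF subn0 addn1.
Qed.

Lemma mlift_remove c j : (c == 0) || (c \in B) ->
  mremove (mlift (c, j)) (c + munit j) j = B.
Proof.
move=> cB; rewrite /mremove maddK /mlift /= msingleDK.
have <- : (c == 0) = (c + munit j == munit j).
  by rewrite -mpred_eq0 ?maddK // maddE munitE eqxx addn1.
case: eqVneq cB => [->|_] /= cB; first by rewrite msingle0 msetB0.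
exact: msingleBK.
Qed.

(** Deleting the added unit brings every lift back to [B], and a deletion with
    given source and result determines the block and the colour. *)
Lemma mlift_inj : {in lifts &, injective mlift}.
Proof.
move=> [c j] [c' j']; rewrite !mem_lifts => cB cB' E.
have memL (d : mindex q) i : d + munit i \in finsupp (mlift (d, i)).
  by rewrite msuppE in_mset mlift_at.
have pos (d : mindex q) i : (0 < (d + munit i)%R i)%N.
  by rewrite maddE munitE eqxx addn1.
have [||cc jj] := mremove_inj (memL c j) _ (pos c j) (pos c' j') _.
- by rewrite E memL.
- by rewrite mlift_remove // E mlift_remove.
by rewrite -(maddK c j) cc jj maddK.
Qed.

Lemma mlift_chrompart n cj : chrompart q n B -> cj \in lifts ->
  chrompart q n.+1 (mlift cj).
Proof.
case: cj => c j Bn; rewrite mem_lifts => /orP[/eqP ->|cB]; rewrite /mlift /=.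
  by rewrite msingle0 msetB0 add0r -[n.+1]addn1 -(mdeg_unit j); exact: chrompartD.
have [cn Bc] := chrompartB Bn cB.
rewrite -(subnK cn) -addnS -[(mdeg c).+1]addn1 -(mdeg_unit j) -mdegD.
exact: chrompartD.
Qed.

Lemma mliftP n A a j : chrompart q n A -> a \in finsupp A -> (0 < a j)%N ->
  B = mremove A a j -> (mpred a j, j) \in lifts /\ mlift (mpred a j, j) = A.
Proof.
move=> An; rewrite msuppE => aA aj BE; rewrite mem_lifts /mlift /= mpredK //.
have := mpred_eq0 aj; move: BE; rewrite /mremove; case: ifP => _ BE p0.
  rewrite p0; split=> //; move/eqP: p0 => ->.
  by rewrite msingle0 msetB0 BE msingleBK.
have -> : mpred a j \in B.
  by rewrite BE in_msetD [in X in _ || X]msingle_neq0 ?p0 // in_mset1 eqxx orbT.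
by rewrite orbT BE msingleDK msingleBK.
Qed.

Lemma sum_lifts (V : nmodType) (F : mindex q -> 'I_q -> V) : B 0 = 0%N ->
  \sum_(cj <- lifts) F cj.1 cj.2 = \sum_j F 0 j + \sum_(c <- finsupp B) \sum_j F c j.
Proof.
by move=> B0; rewrite big_allpairs_dep /= big_cons; congr (_ + _);
  [|apply: eq_bigr => c _]; rewrite big_enum.
Qed.

Lemma lifts_uniq : B 0 = 0%N -> uniq lifts.
Proof.
move=> B0; apply: allpairs_uniq; rewrite ?enum_uniq //=.
  by rewrite fset_uniq andbT msuppE in_mset B0.
by move=> [x y] [x' y'] _ _.
Qed.

End Lift.

(** The partitions that may become [B] are the lifts of [B], each of them for a
    single choice of block and colour. The first sum collects the lifts at the
    zero multi-index. *)
Theorem consistency_identity (R : realType) (P : nat -> chroms q -> R) n B :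
  partition_structure P -> chrompart q n B ->
  n.+1%:R * P n B =
  \sum_j (B (munit j)).+1%:R * P n.+1 (B `+` msingle (munit j))%mset +
  \sum_(c <- finsupp B) \sum_j ((c j).+1 * (B (c + munit j)).+1)%:R *
     P n.+1 ((B `\` msingle c) `+` msingle (c + munit j))%mset.
Proof.
move=> [_ _ PS] Bn; have B0 := Bn.1.
pose F c j := ((c j).+1 * (B (c + munit j)).+1)%:R * P n.+1 (mlift B (c, j)).
transitivity (\sum_(cj <- lifts B) F cj.1 cj.2); last first.
  rewrite sum_lifts //; congr (_ + _); apply: eq_bigr => j _.
  by rewrite /F /mlift /= add0r msingle0 msetB0 ffunE mul1n.
rewrite (PS n.+1 B) //=.
rewrite -(@fsbig_widen _ _ _ _ [set` map (mlift B) (lifts B)]) /=; last 2 first.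
- by move=> _ /= /mapP[cj cjB ->]; exact: mlift_chrompart.
- move=> A [An /= AL]; rewrite down_kernel_eq0 ?mulr0 // => a j aA aj BE.
  have [mL mE] := mliftP An aA aj BE; apply: AL; apply/mapP.
  by exists (mpred a j, j).
rewrite -fsbig_seq; last first.
  by rewrite map_inj_in_uniq ?lifts_uniq //; exact: mlift_inj.
rewrite big_map mulr_sumr big_seq [RHS]big_seq; apply: eq_bigr => -[c j] cjB.
rewrite /F /=; have cB : (c == 0) || (c \in B) by rewrite -(mem_lifts _ c j).
have -> : down_kernel R n.+1 (mlift B (c, j)) B =
    ((c j).+1 * (B (c + munit j)).+1)%:R / n.+1%:R.
  rewrite -{2}(mlift_remove j cB) down_kernel_remove.
  - by rewrite mlift_at maddE munitE eqxx addn1.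
  - by rewrite msuppE in_mset mlift_at.
  - by rewrite maddE munitE eqxx addn1.
by rewrite [LHS]mulrC -mulrA mulfVK ?pnatr_eq0 // mulrC.
Qed.

End ChromaticPartitions.

(** * Deletion ratios force a Gibbs form *)

Section GibbsProducts.
Variables (R : realType) (q : nat).
Implicit Types (A : chroms q) (a r : mindex q) (y : mindex q -> R).

Definition gibbs y A : R := \prod_(a <- finsupp A) ((A a)`!%:R^-1 * y a ^+ A a).

Lemma gibbs_incl y A (S : {fset mindex q}) : (finsupp A `<=` S)%fset ->
  gibbs y A = \prod_(a <- S) ((A a)`!%:R^-1 * y a ^+ A a).
Proof.
move=> AS; apply: big_fset_incl => // a _; rewrite msuppE => /mset_eq0P ->.
by rewrite fact0 invr1 mul1r.
Qed.

Lemma gibbs0 y : gibbs y mset0 = 1.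
Proof. by rewrite /gibbs finsupp0 big_nil. Qed.

Lemma gibbsD y A r : r != 0 ->
  (A r).+1%:R * gibbs y (A `+` msingle r)%mset = y r * gibbs y A.
Proof.
move=> r0; rewrite msingle_neq0 //.
set S := (finsupp A `|` [fset r])%fset.
have rS : r \in S by rewrite !inE eqxx orbT.
rewrite (@gibbs_incl y (A `+` [mset r])%mset S) ?finsuppD ?finsupp_msetn //.
rewrite (@gibbs_incl y A S) ?fsubsetUl // !(big_fsetD1 r rS) /=.
rewrite msetE2 msetnxx addn1 factS natrM invfM exprSr.
rewrite [X in _ * (_ * X)](_ : _ =
  \prod_(a <- (S `\ r)%fset) ((A a)`!%:R^-1 * y a ^+ A a)); last first.
  apply: eq_big_seq => a; rewrite !inE => /andP[/negbTE ar _].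
  by rewrite msetE2 msetnE ar addn0.
have k0 : (A r).+1%:R != 0 :> R by rewrite pnatr_eq0.
by rewrite !mulrA mulfV // mul1r; congr (_ * _); rewrite [LHS]mulrC mulrA.
Qed.

Lemma gibbs_single y r : r != 0 -> gibbs y (msingle r) = y r.
Proof.
move=> r0; have := gibbsD y mset0 r0.
by rewrite mset0D mset0E gibbs0 mulr1 mul1r.
Qed.

Lemma gibbs_scale y (g : R) A :
  gibbs (fun a => y a / g ^+ mdeg a) A = gibbs y A / g ^+ weight A.
Proof.
rewrite /gibbs /weight -prodrXr -prodf_div; apply: eq_bigr => a _.
by rewrite exprMn exprVn -exprM mulrA [(mdeg a * _)%N]mulnC.
Qed.

Lemma eq_gibbs y z A : A 0 = 0%N -> (forall a, a != 0 -> y a = z a) ->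
  gibbs y A = gibbs z A.
Proof.
move=> A0 yz; apply: eq_big_seq => a aA; rewrite yz //.
by apply: contraTneq aA => ->; rewrite msuppE; apply/mset_eq0P.
Qed.

End GibbsProducts.

Section MultinomialCoefficient.
Variables (R : realType) (q : nat).
Implicit Types (a : mindex q) (j : 'I_q).

Lemma multinom_coef_gt0 a : 0 < multinom_coef R a.
Proof.
rewrite /multinom_coef divr_gt0 ?ltr0n ?fact_gt0 //.
by rewrite prodn_gt0 // => j; exact: fact_gt0.
Qed.

Lemma multinom_coefS a j :
  multinom_coef R (a + munit j) * (a j).+1%:R =
  multinom_coef R a * (mdeg a).+1%:R.
Proof.
rewrite /multinom_coef mdegD mdeg_unit addn1 factS.
have -> : (\prod_i ((a + munit j)%R i)`! = (a j).+1 * \prod_i (a i)`!)%N.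
  rewrite (bigD1 j) //= maddE munitE eqxx addn1 factS -mulnA; congr (_ * _)%N.
  rewrite [in RHS](bigD1 j) //=; congr (_ * _)%N; apply: eq_bigr => i /negbTE ij.
  by rewrite maddE munitE ij addn0.
have p0 : (\prod_i (a i)`!)%N%:R != 0 :> R.
  by rewrite pnatr_eq0 -lt0n prodn_gt0 // => i; exact: fact_gt0.
have x0 : (a j).+1%:R != 0 :> R by rewrite pnatr_eq0.
rewrite !natrM; move: x0 p0; move: (_.+1%:R : R) (_.+1%:R : R) => x y x0 p0.
by field; rewrite p0 x0.
Qed.

Lemma multinom_coef_unit j : multinom_coef R (munit j) = 1.
Proof.
have := multinom_coefS 0 j; rewrite add0r ffunE mdeg0 !mulr1 => ->.
rewrite /multinom_coef mdeg0 big1 ?divff ?oner_neq0 // => i _.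
by rewrite ffunE.
Qed.

End MultinomialCoefficient.

Section RisingFactorial.
Variables (R : realType) (theta : R).

Lemma rising0 : rising theta 0 = 1.
Proof. by rewrite /rising big_ord0. Qed.

Lemma risingS n : rising theta n.+1 = rising theta n * (theta + n%:R).
Proof. by rewrite /rising big_ord_recr. Qed.

Lemma rising_gt0 n : 0 < theta -> 0 < rising theta n.
Proof. by move=> t0; apply: prodr_gt0 => i _; rewrite ltr_wpDr. Qed.

End RisingFactorial.

Section DeletionRatios.
Variables (R : realType) (q : nat) (j0 : 'I_q).
Variables (P : nat -> chroms q -> R) (b : nat -> mindex q -> R).
Hypotheses (hP : partition_structure P)
  (ha1 : forall j : 'I_q, block_support P (munit j))
  (ha2 : forall (n : nat) (A : chroms q), (0 < n)%N -> chrompart q n A ->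
    [set` finsupp A] `<=` block_support P -> 0 < P n A)
  (ha3 : exists2 c : mindex q, block_support P c & mdeg c = 2%N)
  (hb : forall (n : nat) (A : chroms q) (r : mindex q), (0 < n)%N ->
    chrompart q n A -> r != 0 -> (msingle r `<=` A)%mset ->
    (mdeg r)%:R * (A r)%:R * P n A =
      b n r * P (n - mdeg r)%N (A `\` msingle r)%mset).
Implicit Types (A B : chroms q) (a c r : mindex q) (j : 'I_q) (k n : nat).

Let e := munit j0.

Lemma mass_ge0 n A : chrompart q n A -> 0 <= P n A.
Proof. by case: hP => + _ _; exact. Qed.

Lemma mass_empty : P 0 mset0 = 1.
Proof.
case: hP => _ /(_ 0%N) + _; rewrite (_ : chrompart q 0 = [set mset0]).
  by rewrite fsbig_set1.
apply/seteqP; split=> A /=; first exact: chrompart0E.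
by move=> ->; exact: chrompart0.
Qed.

(** The deletion hypothesis read from the smaller partition [A]. *)
Lemma add_block n A r : chrompart q n A -> r != 0 ->
  (mdeg r)%:R * (A r).+1%:R * P (n + mdeg r)%N (A `+` msingle r)%mset =
  b (n + mdeg r)%N r * P n A.
Proof.
move=> An r0; have := @hb (n + mdeg r)%N _ r _ (chrompartD r An) r0 _.
rewrite addnK msingleDK msetE2 msingleE r0 eqxx addn1; apply.
  by rewrite addn_gt0 mdeg_gt0 r0 orbT.
by rewrite msingle_sub // in_msetD [in X in _ || X]msingle_neq0 // in_mset1 eqxx orbT.
Qed.

Definition singles k : chroms q := msetn k e.

Lemma singlesS k : singles k.+1 = (singles k `+` msingle e)%mset.
Proof.
apply/msetP => a; rewrite /singles msetE2 msingle_neq0 ?munit_neq0 // !msetnE.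
by case: eqP => _; rewrite ?addn1.
Qed.

Lemma singles_chrompart k : chrompart q k (singles k).
Proof.
elim: k => [|k IH]; first by rewrite /singles msetn0; exact: chrompart0.
by rewrite singlesS -addn1 -(mdeg_unit j0); exact: chrompartD.
Qed.

Lemma singles_gt0 k : 0 < P k (singles k).
Proof.
case: k => [|k]; first by rewrite /singles msetn0 mass_empty.
apply: ha2 => //; first exact: singles_chrompart.
by move=> a; rewrite /= /singles finsupp_msetn /= inE => /eqP ->; exact: ha1.
Qed.

(** The ratio for a singleton of colour [j0]; positive, and enough to express all
    the dependence of [b] on the size. *)
Definition rate k := b k.+1 e.

Lemma rate_singles k : k.+1%:R * P k.+1 (singles k.+1) = rate k * P k (singles k).
Proof.
have := add_block (singles_chrompart k) (munit_neq0 j0).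
by rewrite mdeg_unit mul1r addn1 -singlesS /singles msetnxx.
Qed.

Lemma rate_gt0 k : 0 < rate k.
Proof.
by rewrite -(pmulr_lgt0 _ (singles_gt0 k)) -rate_singles mulr_gt0 // singles_gt0.
Qed.

Definition norming n : R := \prod_(k < n) rate k.

Lemma normingS n : norming n.+1 = norming n * rate n.
Proof. by rewrite /norming big_ord_recr. Qed.

Lemma norming0 : norming 0 = 1.
Proof. exact: big_ord0. Qed.

Lemma norming_gt0 n : 0 < norming n.
Proof. by apply: prodr_gt0 => k _; exact: rate_gt0. Qed.

(** A block [r] and a singleton are taken off [singles k.+1] together with [r], in
    both orders. The outcome [singles k] has positive mass, which cancels. *)
Lemma rate_commute k r : r != 0 ->
  b (k.+1 + mdeg r)%N r * rate k = rate (k + mdeg r)%N * b (k + mdeg r)%N r.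
Proof.
move=> r0; have [->|re] := eqVneq r e.
  by rewrite mdeg_unit !addn1 mulrC [in RHS]mulrC [RHS]mulrC.
have onesr i : singles i r = 0%N by rewrite /singles msetnE (negbTE re).
have E1 := add_block (singles_chrompart k.+1) r0.
have E2 := add_block (chrompartD r (singles_chrompart k)) (munit_neq0 j0).
have E3 := add_block (singles_chrompart k) r0.
rewrite onesr mulr1 in E1; rewrite onesr mulr1 in E3.
have er : (singles k `+` msingle r)%mset e = k.
  by rewrite msetE2 msingleE r0 eq_sym (negbTE re) addn0 /singles msetnxx.
rewrite -/e er mdeg_unit mul1r msetDAC -singlesS addn1 -/(rate _) in E2.
apply: (mulIf (lt0r_neq0 (singles_gt0 k))).
rewrite -mulrA -rate_singles mulrCA -E1 -[RHS]mulrA -E3 [RHS]mulrCA -E2.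
by rewrite mulrCA addSn.
Qed.

Definition block_weight r : R := b (mdeg r) r / norming (mdeg r).

Lemma ratio_factorization k r : r != 0 ->
  b (k + mdeg r)%N r * norming k = block_weight r * norming (k + mdeg r)%N.
Proof.
move=> r0; elim: k => [|k IH].
  by rewrite add0n /block_weight norming0 mulr1 divfK // lt0r_neq0 // norming_gt0.
rewrite normingS mulrA mulrAC rate_commute // -mulrA IH addSn normingS.
by rewrite mulrCA [rate _ * _]mulrC.
Qed.

(** Induction on the blocks: both sides are multiplied by the same factor when a
    block is added, by [ratio_factorization] on the left and [gibbsD] on the right. *)
Theorem gibbs_form n A : chrompart q n A ->
  P n A = norming n * gibbs (fun a => block_weight a / (mdeg a)%:R) A.
Proof.
elim: {n}_.+1 {-2}n (ltnSn n) A => // N IH n nN A An.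
have [A0|[r rA]] := mset_0Vmem A.
  have n0 : n = 0%N by rewrite -An.2 A0 -/(weight _) weight0.
  by rewrite A0 n0 mass_empty gibbs0 norming0 mulr1.
have r0 := chrompart_neq0 An rA; have [rn Ar] := chrompartB An rA.
set A' := (A `\` msingle r)%mset in Ar; set n' := (n - mdeg r)%N in Ar.
have AE : A = (A' `+` msingle r)%mset by rewrite msingleBK.
have nE : n = (n' + mdeg r)%N by rewrite subnK.
have d0 : (0 < mdeg r)%N by rewrite mdeg_gt0.
have n'N : (n' < N)%N by rewrite -ltnS (leq_trans _ nN) // ltnS nE -addn1 leq_add2l.
have := add_block Ar r0.
rewrite -AE -nE (IH _ n'N _ Ar) mulrA [n in b n]nE ratio_factorization // -nE.
have := gibbsD (fun a => block_weight a / (mdeg a)%:R) A' r0; rewrite -AE => G E.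
have dR : (mdeg r)%:R != 0 :> R by rewrite pnatr_eq0 -lt0n.
have sR : (A' r).+1%:R != 0 :> R by rewrite pnatr_eq0.
apply: (mulfI dR); apply: (mulfI sR).
rewrite mulrA [X in X * _]mulrC E.
rewrite [RHS]mulrCA [_.+1%:R * _]mulrCA G.
by field.
Qed.

Lemma mass_single r : r != 0 ->
  P (mdeg r) (msingle r) = norming (mdeg r) * (block_weight r / (mdeg r)%:R).
Proof.
move=> r0; rewrite (@gibbs_form (mdeg r)) ?gibbs_single //.
by have := chrompartD r (chrompart0 q); rewrite mset0D.
Qed.

Lemma block_supportE r : r != 0 -> block_support P r <-> 0 < block_weight r.
Proof.
move=> r0; rewrite /block_support /= mass_single // pmulr_rgt0 ?norming_gt0 //.
by rewrite pmulr_lgt0 // invr_gt0 ltr0n mdeg_gt0.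
Qed.

Lemma block_weight_ge0 r : r != 0 -> 0 <= block_weight r.
Proof.
move=> r0; have : 0 <= P (mdeg r) (msingle r).
  by apply: mass_ge0; have := chrompartD r (chrompart0 q); rewrite mset0D.
rewrite mass_single // pmulr_rge0 ?norming_gt0 //.
by rewrite pmulr_lge0 // invr_gt0 ltr0n mdeg_gt0.
Qed.

(** * The scale parameter and the moment weights *)

Definition unit_weight : R := \sum_j block_weight (munit j).

(** The weight that consistency assigns to a block [c] through the blocks obtained
    from it by adding a unit. *)
Definition lifted_weight c : R :=
  \sum_j (c j).+1%:R / (mdeg c).+1%:R * block_weight (c + munit j).

(** Each mass in [consistency_identity] belongs to a partition obtained by adding a
    block to a smaller one; [add_block] and [ratio_factorization] bring all of
    them back to masses of size at most [n]. *)
Lemma consistency_rates n B : chrompart q n B ->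
  n.+1%:R * P n B = rate n * (unit_weight * P n B + \sum_(c <- finsupp B)
    lifted_weight c * (norming n / norming (n - mdeg c)) *
    P (n - mdeg c)%N (B `\` msingle c)%mset).
Proof.
move=> Bn; have Wn0 k : norming k != 0 by rewrite lt0r_neq0 // norming_gt0.
rewrite (consistency_identity hP Bn) mulrDr; congr (_ + _).
  rewrite mulrA mulr_sumr mulr_suml; apply: eq_bigr => j _.
  have := add_block Bn (munit_neq0 j); rewrite mdeg_unit mul1r addn1 => ->.
  congr (_ * _); apply: (mulIf (Wn0 n)).
  have := @ratio_factorization n (munit j) (munit_neq0 j).
  rewrite mdeg_unit addn1 normingS => ->.
  by ring.
rewrite mulr_sumr; apply: eq_big_seq => c; rewrite msuppE => cB.
have [cn Bc] := chrompartB Bn cB.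
rewrite !mulr_suml mulr_sumr; apply: eq_bigr => j _.
have a0 := madd_unit_neq0 c j.
have E := add_block Bc a0.
have c0 := chrompart_neq0 Bn cB.
have nE : (n - mdeg c + mdeg (c + munit j)%R = n.+1)%N.
  by rewrite mdegD mdeg_unit addn1 addnS subnK.
have BE : ((B `\` msingle c)%mset (c + munit j) = B (c + munit j)).
  by rewrite msetE2 msingleE (negbTE (madd_unit_neq c j)) andbF subn0.
have W := @ratio_factorization (n - mdeg c) _ a0.
rewrite nE BE mdegD mdeg_unit addn1 in E; rewrite nE normingS in W.
have d0 : (mdeg c).+1%:R != 0 :> R by rewrite pnatr_eq0.
rewrite natrM -mulrA.
transitivity ((c j).+1%:R / (mdeg c).+1%:R *
  (b n.+1 (c + munit j) * P (n - mdeg c)%N (B `\` msingle c)%mset)).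
  by rewrite -E; field.
have -> : b n.+1 (c + munit j) =
    block_weight (c + munit j) * (norming n * rate n) / norming (n - mdeg c).
  by rewrite -W mulfK.
by field; rewrite Wn0 nat1r.
Qed.

Let g := lifted_weight e.

(** Consistency at [singles k]: adding a unit either creates a block or enlarges
    one of the [k] singletons. *)
Lemma rateE k : k.+1%:R = rate k * (unit_weight + k%:R * g).
Proof.
have := consistency_rates (singles_chrompart k).
have P0 := lt0r_neq0 (singles_gt0 k).
case: k P0 => [|k] P0.
  rewrite /singles msetn0 finsupp0 big_nil mass_empty !mulr1 !addr0 mul0r addr0.
  exact.
rewrite {3}/singles finsupp_msetn /= big_seq_fset1 mdeg_unit subn1 /=.
rewrite [in X in P k X]singlesS msingleDK normingS -/g.
rewrite [norming k * _]mulrC mulfK; last by rewrite lt0r_neq0 // norming_gt0.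
rewrite -(mulrA g) -rate_singles => E.
apply: (mulIf P0); rewrite E; ring.
Qed.

(** Consistency at the partition with the single block [c], compared with the same
    identity at [mdeg c] singletons, which has the same rate. *)
Lemma lifted_weightE c : c != 0 -> lifted_weight c = g * block_weight c.
Proof.
move=> c0; have cc : chrompart q (mdeg c) (msingle c).
  by have := chrompartD c (chrompart0 q); rewrite mset0D.
have := consistency_rates cc.
have -> : finsupp (msingle c) = [fset c]%fset.
  by rewrite msingle_neq0 // finsupp_msetn.
rewrite big_seq_fset1 subnn.
rewrite msetBxx mass_empty mass_single // norming0 rateE.
have d0 : (mdeg c)%:R != 0 :> R by rewrite pnatr_eq0 -lt0n mdeg_gt0.
have W0 : norming (mdeg c) != 0 by rewrite lt0r_neq0 // norming_gt0.
have r0 : rate (mdeg c) != 0 by rewrite lt0r_neq0 // rate_gt0.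
rewrite -mulrA => /(mulfI r0) E; apply/eqP; rewrite -subr_eq0.
(* The difference is that of the two sides of E, divided by the norming. *)
have -> : lifted_weight c - g * block_weight c =
    (unit_weight * (norming (mdeg c) * (block_weight c / (mdeg c)%:R)) +
    lifted_weight c * (norming (mdeg c) / 1) * 1
  - (unit_weight + (mdeg c)%:R * g) *
    (norming (mdeg c) * (block_weight c / (mdeg c)%:R)))
  / norming (mdeg c).
  by field; rewrite W0 d0.
by rewrite E subrr mul0r.
Qed.

Lemma block_weight_unit_gt0 j : 0 < block_weight (munit j).
Proof. by apply/block_supportE; [exact: munit_neq0|exact: ha1]. Qed.

Lemma unit_weight_gt0 : 0 < unit_weight.
Proof.
rewrite /unit_weight (bigD1 j0) //= ltr_wpDr ?block_weight_unit_gt0 //.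
by apply: sumr_ge0 => j _; exact/ltW/block_weight_unit_gt0.
Qed.

(** Taking a unit off the block of size two in the support leaves a unit vector
    [munit i], whose lifted weight is then positive; it equals [g] times the weight
    of [munit i]. *)
Lemma lifted_weight_gt0 : 0 < g.
Proof.
have [c cS c2] := ha3; have [|j cj] := @mdeg_gt0_coord _ c; first by rewrite c2.
have [i ci] : exists i, mpred c j = munit i.
  by apply: mdeg1P; move: c2; rewrite (mdeg_pred cj) => -[].
have c0 : c != 0 by rewrite -mdeg_gt0 c2.
have wc : 0 < block_weight c by apply/block_supportE.
have : 0 < lifted_weight (munit i).
  rewrite /lifted_weight (bigD1 j) //= ltr_wpDr //.
    apply: sumr_ge0 => k _; apply: mulr_ge0; first exact: divr_ge0.
    by apply: block_weight_ge0; exact: madd_unit_neq0.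
  by rewrite -ci mpredK //; apply: mulr_gt0 => //; exact: divr_gt0.
by rewrite lifted_weightE ?munit_neq0 // pmulr_lgt0 // block_weight_unit_gt0.
Qed.

(** The parameter [theta] of the sampling formula that represents [P]. *)
Definition scale_parameter : R := unit_weight / g.

Let theta := scale_parameter.

Lemma scale_gt0 : 0 < theta.
Proof. by rewrite divr_gt0 ?unit_weight_gt0 ?lifted_weight_gt0. Qed.

(** By [rateE], [rate n] equals [n.+1%:R / (g * (theta + n%:R))]. *)
Lemma normingE n : norming n = n`!%:R / (g ^+ n * rising theta n).
Proof.
have g0 := lt0r_neq0 lifted_weight_gt0.
elim: n => [|n IH]; first by rewrite norming0 rising0 mulr1 divr1.
have t0 : theta + n%:R != 0 by rewrite lt0r_neq0 // ltr_wpDr // scale_gt0.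
have tE : unit_weight + n%:R * g = g * (theta + n%:R).
  by rewrite /theta /scale_parameter; field.
have r0 := lt0r_neq0 (rising_gt0 n scale_gt0).
rewrite normingS risingS IH factS natrM (rateE n) tE exprS; field.
by rewrite g0 r0 t0 expf_neq0.
Qed.

(** The value forced on the moment of order [a] by comparing the Gibbs form with
    the sampling formula. *)
Definition moment_weight a : R :=
  if a == 0 then 1 else block_weight a / (g ^+ mdeg a * theta * multinom_coef R a).

Lemma block_weightE a : a != 0 ->
  block_weight a = moment_weight a * (g ^+ mdeg a * theta * multinom_coef R a).
Proof.
move=> a0; rewrite /moment_weight (negbTE a0) divfK //.
have [g0 t0 C0] := And3 lifted_weight_gt0 scale_gt0 (multinom_coef_gt0 R a).
exact: lt0r_neq0 (mulr_gt0 (mulr_gt0 (exprn_gt0 _ g0) t0) C0).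
Qed.

Lemma moment_weight_ge0 a : 0 <= moment_weight a.
Proof.
rewrite /moment_weight; case: eqVneq => // a0.
apply: divr_ge0; first exact: block_weight_ge0.
have [g0 t0 C0] := And3 lifted_weight_gt0 scale_gt0 (multinom_coef_gt0 R a).
exact: ltW (mulr_gt0 (mulr_gt0 (exprn_gt0 _ g0) t0) C0).
Qed.

(** For [c != 0] this is [lifted_weightE], the multinomial coefficients turning the
    factors [(c j).+1%:R / (mdeg c).+1%:R] into 1; for [c = 0] it is the choice of
    [theta]. *)
Lemma moment_weight_recursion c : moment_weight c = \sum_j moment_weight (c + munit j).
Proof.
have g0 := lt0r_neq0 lifted_weight_gt0; have t0 := lt0r_neq0 scale_gt0.
have [->|c0] := eqVneq c 0.
  rewrite {1}/moment_weight eqxx.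
  transitivity (unit_weight / (g * theta)).
    by rewrite /theta /scale_parameter; field; rewrite g0 lt0r_neq0 // unit_weight_gt0.
  rewrite /unit_weight mulr_suml; apply: eq_bigr => j _.
  rewrite add0r /moment_weight (negbTE (munit_neq0 j)) mdeg_unit.
  by rewrite multinom_coef_unit mulr1.
have C0 := lt0r_neq0 (multinom_coef_gt0 R c).
have gn0 := expf_neq0 (mdeg c) g0.
transitivity (lifted_weight c / (g ^+ (mdeg c).+1 * theta * multinom_coef R c)).
  rewrite lifted_weightE // /moment_weight (negbTE c0) exprS; field.
  by rewrite C0 t0 gn0 g0.
rewrite /lifted_weight mulr_suml; apply: eq_bigr => j _.
rewrite /moment_weight (negbTE (madd_unit_neq0 c j)) mdegD mdeg_unit addn1.
have D0 := lt0r_neq0 (multinom_coef_gt0 R (c + munit j)).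
have E := multinom_coefS R c j.
have n0 : (mdeg c).+1%:R != 0 :> R by rewrite pnatr_eq0.
have -> : multinom_coef R c =
    multinom_coef R (c + munit j) * (c j).+1%:R / (mdeg c).+1%:R.
  by rewrite E mulfK.
by rewrite exprS; field; rewrite D0 t0 gn0 g0 !nat1r !pnatr_eq0.
Qed.

Lemma moment_weight_gt0 a : block_support P a <-> 0 < moment_weight a.
Proof.
have [->|a0] := eqVneq a 0.
  by rewrite /block_support /= mdeg0 msingle0 mass_empty /moment_weight eqxx.
have [g0 t0 C0] := And3 lifted_weight_gt0 scale_gt0 (multinom_coef_gt0 R a).
rewrite block_supportE // block_weightE // pmulr_lgt0 //.
exact: mulr_gt0 (mulr_gt0 (exprn_gt0 _ g0) t0) C0.
Qed.

Section Representation.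
Variable nu : probability (borel_rV R q) R.
Hypothesis nu_moment : forall a, moment nu a = moment_weight a.

Lemma ewens_representation n A : chrompart q n A -> P n A = ewens theta nu n A.
Proof.
move=> An; rewrite (gibbs_form An) normingE.
have -> : ewens theta nu n A = n`!%:R / rising theta n *
  gibbs (fun a => theta / (mdeg a)%:R * multinom_coef R a * moment nu a) A by [].
rewrite [in RHS](@eq_gibbs _ _ _
  (fun a => (block_weight a / (mdeg a)%:R) / g ^+ mdeg a)); last 2 first.
- exact: An.1.
- move=> a a0 /=; rewrite nu_moment block_weightE //.
  have d0 : (mdeg a)%:R != 0 :> R by rewrite pnatr_eq0 -lt0n mdeg_gt0.
  by field; rewrite d0 expf_neq0 // lt0r_neq0 // lifted_weight_gt0.
rewrite (gibbs_scale (fun a => block_weight a / (mdeg a)%:R)) (An.2 : weight A = n).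
field; rewrite expf_neq0 ?lt0r_neq0 ?lifted_weight_gt0 //= ?rising_gt0 ?scale_gt0 //.
Qed.

Lemma bstar_representation n r : r != 0 -> (mdeg r <= n)%N ->
  b n r = bstar theta nu n r.
Proof.
move=> r0 rn; set k := (n - mdeg r)%N; have nE : n = (k + mdeg r)%N by rewrite subnK.
apply: (mulIf (lt0r_neq0 (norming_gt0 k))).
rewrite {1}nE ratio_factorization // -nE /bstar -/k nu_moment block_weightE //.
rewrite !normingE.
have g0 := lt0r_neq0 lifted_weight_gt0.
have -> : g ^+ n = g ^+ k * g ^+ mdeg r by rewrite -exprD -nE.
field; rewrite !expf_neq0 //= !lt0r_neq0 ?rising_gt0 ?scale_gt0 ?ltr0n ?fact_gt0 //.
Qed.

Lemma moment_support_representation : block_support P = moment_support nu.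
Proof.
apply/seteqP; split => a; rewrite /moment_support /= nu_moment.
  by move/moment_weight_gt0.
by move=> a0; apply/moment_weight_gt0.
Qed.

End Representation.

End DeletionRatios.

(** * The sampling formula determines its parameters *)

Section ParameterUniqueness.
Variables (R : realType) (q : nat).
Implicit Types (theta : R) (nu : probability (borel_rV R q) R) (a : mindex q).

Lemma moment0 nu : on_simplex nu -> moment nu 0 = 1.
Proof.
move=> nuS; rewrite /moment.
rewrite (@eq_Rintegral _ _ _ _ _ (cst 1)); last first.
  by move=> u _; exact: monom0.
have mS : measurable (simplex R q : set (borel_rV R q)) by exact: measurable_simplex.
by rewrite (Rintegral_cst _ mS) mul1r [X in fine X]nuS.
Qed.

Lemma ewensE theta nu n (A : chroms q) : ewens theta nu n A = n`!%:R / rising theta n *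
  gibbs (fun a => theta / (mdeg a)%:R * multinom_coef R a * moment nu a) A.
Proof. by []. Qed.

Lemma ewens_single theta nu a : a != 0 ->
  ewens theta nu (mdeg a) (msingle a) = (mdeg a)`!%:R / rising theta (mdeg a) *
    (theta / (mdeg a)%:R * multinom_coef R a * moment nu a).
Proof. by move=> a0; rewrite ewensE gibbs_single. Qed.

Lemma ewens_unit theta nu j : 0 < theta ->
  ewens theta nu 1 (msingle (munit j)) = moment nu (munit j).
Proof.
move=> t0; have := ewens_single theta nu (munit_neq0 j); rewrite mdeg_unit => ->.
rewrite multinom_coef_unit risingS rising0 factS fact0 addr0.
by field; exact: lt0r_neq0.
Qed.

(** This value determines [theta]: a singleton gives the moment, and
    [theta / (theta + 1)] is injective in [theta]. *)
Lemma ewens_two_units theta nu j : 0 < theta ->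
  ewens theta nu 2 (msingle (munit j) `+` msingle (munit j))%mset =
  moment nu (munit j) ^+ 2 * (theta / (theta + 1)).
Proof.
move=> t0; rewrite ewensE.
set y := fun a => _.
have := gibbsD y (msingle (munit j)) (munit_neq0 j).
rewrite msingleE munit_neq0 eqxx /= gibbs_single ?munit_neq0 //.
rewrite {2 3}/y mdeg_unit multinom_coef_unit => E.
set G := gibbs y _ in E *.
have -> : G = (theta * moment nu (munit j)) ^+ 2 / 2.
  by apply: (mulfI (x := 2)) => //; rewrite E; field.
rewrite !risingS rising0 addr0 mul1r (_ : 2`! = 2)%N //; field.
by rewrite !lt0r_neq0 // addr_gt0.
Qed.

(** Partitions of size 1 give the moments of order 1, two equal singletons give
    [theta], and then the partition with one block [a] gives the moment of order
    [a]. *)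
Lemma ewens_injective theta nu theta' nu' (j : 'I_q) :
  on_simplex nu -> on_simplex nu' -> 0 < theta -> 0 < theta' ->
  moment nu (munit j) != 0 ->
  (forall n A, chrompart q n A -> ewens theta nu n A = ewens theta' nu' n A) ->
  theta = theta' /\ forall a, moment nu a = moment nu' a.
Proof.
move=> nuS nuS' t0 t0' m0 E.
have single_part a : chrompart q (mdeg a) (msingle a).
  by have := chrompartD a (chrompart0 q); rewrite mset0D.
have m1 : moment nu (munit j) = moment nu' (munit j).
  rewrite -(ewens_unit nu j t0) -(ewens_unit nu' j t0'); apply: E.
  by have := single_part (munit j); rewrite mdeg_unit.
have tt : theta = theta'.
  have /E : chrompart q 2 (msingle (munit j) `+` msingle (munit j))%mset.
    by have := chrompartD (munit j) (single_part (munit j)); rewrite mdeg_unit.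
  rewrite !ewens_two_units // -m1 => /(mulfI (expf_neq0 2 m0)) h.
  have p1 : theta + 1 != 0 by rewrite lt0r_neq0 // addr_gt0.
  have p2 : theta' + 1 != 0 by rewrite lt0r_neq0 // addr_gt0.
  move/eqP: h; rewrite eqr_div // !mulrDr !mulr1 mulrC => /eqP.
  by move/addrI.
subst theta'; split=> // a; have [->|a0] := eqVneq a 0; first by rewrite !moment0.
have := E _ _ (single_part a); rewrite !ewens_single //.
have d0 : (0 : R) < (mdeg a)%:R by rewrite ltr0n mdeg_gt0.
have f0 : (0 : R) < (mdeg a)`!%:R / rising theta (mdeg a).
  by rewrite divr_gt0 ?rising_gt0 // ltr0n fact_gt0.
have c0 := mulr_gt0 (divr_gt0 t0 d0) (multinom_coef_gt0 R a).
by move=> /(mulfI (lt0r_neq0 f0)) /(mulfI (lt0r_neq0 c0)).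
Qed.

End ParameterUniqueness.

(** * The characterisation *)

Theorem theorem4p17 (R : realType) (q : nat) (hq : (0 < q)%N)
    (P : nat -> chroms q -> R) (b : nat -> mindex q -> R)
    (hP : partition_structure P)
    (ha1 : forall j : 'I_q, block_support P (munit j))
    (ha2 : forall (n : nat) (A : chroms q), (0 < n)%N -> chrompart q n A ->
      [set` finsupp A] `<=` block_support P -> 0 < P n A)
    (ha3 : exists2 c : mindex q, block_support P c & mdeg c = 2%N)
    (hb : forall (n : nat) (A : chroms q) (r : mindex q), (0 < n)%N ->
      chrompart q n A -> r != 0 -> (msingle r `<=` A)%mset ->
      (mdeg r)%:R * (A r)%:R * P n A =
        b n r * P (n - mdeg r)%N (A `\` msingle r)%mset) :
  exists (theta : R) (nu : probability (borel_rV R q) R),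
    [/\ [/\ 0 < theta, on_simplex nu
          & forall n A, chrompart q n A -> P n A = ewens theta nu n A],
        forall (theta' : R) (nu' : probability (borel_rV R q) R),
          0 < theta' -> on_simplex nu' ->
          (forall n A, chrompart q n A -> P n A = ewens theta' nu' n A) ->
          theta' = theta /\
          (forall B : set (borel_rV R q), measurable B -> nu' B = nu B),
        block_support P = moment_support nu
      & forall (n : nat) (r : mindex q), (0 < n)%N -> r != 0 ->
          (mdeg r <= n)%N -> b n r = bstar theta nu n r].
Proof.
pose j0 := Ordinal hq.
have m0 : moment_weight j0 b 0 = 1 by rewrite /moment_weight eqxx.
have [nu [nuS nuE]] := exists_representing_measure j0
  (moment_weight_ge0 j0 hP ha1 ha2 ha3 hb) m0
  (moment_weight_recursion j0 hP ha1 ha2 ha3 hb).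
have t0 := scale_gt0 j0 hP ha1 ha2 ha3 hb.
have PE := ewens_representation hP ha1 ha2 ha3 hb nuE.
exists (scale_parameter j0 b), nu; split.
- by split.
- move=> theta' nu' t0' nuS' PE'.
  have e0 : moment nu (munit j0) != 0.
    rewrite nuE; apply: lt0r_neq0.
    by apply/(moment_weight_gt0 j0 hP ha1 ha2 ha3 hb).
  have [|tt mm] := ewens_injective nuS nuS' t0 t0' e0.
    by move=> n A An; rewrite -PE // -PE'.
  split=> // B mB.
  by apply: eq_measure_of_moments => // a; rewrite mm.
- exact: (moment_support_representation hP ha1 ha2 ha3 hb nuE).
- move=> n r _ r0 rn.
  exact: (bstar_representation hP ha1 ha2 ha3 hb nuE r0 rn).
Qed.
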